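(* Let $G=(I,P;E)$ be a pinned isostatic graph. The following are equivalent: (i) $G$ is minimal as a pinned isostatic graph: for every proper subset $I'\cup P'$ of the vertex set (with $I'\subseteq I$, $P'\subseteq P$), the induced pinned subgraph $G'=(I'\cup P';E')$ satisfies $|E'|\le 2|I'|-1$. (ii) If the set $P$ is contracted to a single vertex $p^*$, the resulting unpinned (multi)graph $G^*$ with edge set $E$ is a rigidity circuit. (iii) Either $G$ has a single inner vertex, of degree $2$, or whenever an inner vertex is deleted, the resulting pinned graph (with inner vertices in generic position) has a motion in which all inner vertices move. (iv) Deletion of any edge of $G$ results in a pinned graph that (with inner vertices in generic position) has a motion in which all inner vertices move.
   Context: A pinned graph $G(I,P;E)$ consists of a finite set $I$ of inner vertices, a finite set $P$ of pinned vertices (disjoint from $I$), and a set $E$ of edges, each joining two distinct vertices and having at least one endpoint in $I$. It is pinned isostatic if $|E|=2|I|$ and the graph $G\cup K_P$, obtained by adding a complete graph on a vertex set containing all pins (and no inner vertices), is generically rigid in the plane as an ordinary graph (its rigidity matrix at a generic placement of $n$ vertices has rank $2n-3$). For a subset of vertices, the induced pinned subgraph consists of those vertices and all edges of $E$ with both endpoints in the subset. The rigidity matrix of a graph with vertices placed at $\mathbf{p}_v\in\mathbb{R}^2$ has one row per edge $(i,j)$ with $\mathbf{p}_i-\mathbf{p}_j$ in the columns of $i$, $\mathbf{p}_j-\mathbf{p}_i$ in the columns of $j$, zeros elsewhere. A rigidity circuit is a nonempty edge set $C$ with $|C|=2|V(C)|-2$ such that every nonempty proper subset $F\subsetneq C$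 satisfies $|F|\le 2|V(F)|-3$, where $V(F)$ is the set of vertices incident to $F$ (parallel edges are allowed in $G^*$). In a pinned framework the pin positions are fixed; a motion is a (first-order) displacement of the inner vertices preserving all edge lengths to first order, i.e. velocities $\mathbf{p}'_v$ (with $\mathbf{p}'_v=0$ for pins) such that $(\mathbf{p}_i-\mathbf{p}_j)\cdot(\mathbf{p}'_i-\mathbf{p}'_j)=0$ for every edge $(i,j)$; ''all inner vertices move'' means $\mathbf{p}'_v\neq 0$ for every inner vertex $v$. Inner vertices are in generic position if every minor of the rigidity matrix not identically zero as a polynomial in the inner vertex coordinates (pins fixed) is nonzero. A pinned graph satisfying these equivalent conditions is called an Assur graph.
   Formalization: The formal version assumes I is nonempty, every pin lies on an edge, pins sit at distinct points and K_P has at least two vertices; in (i) it requires I' nonempty. Without these the equivalence fails, e.g. with an isolated pin or two coincident pins. *)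

(* Defs.v *)
From mathcomp Require Import all_boot all_order all_algebra.
From mathcomp Require Import reals.

Set Implicit Arguments.
Unset Strict Implicit.
Unset Printing Implicit Defensive.

Import GRing.Theory.
Local Open Scope ring_scope.

(* The vertices of G(I,P;E) live in an ambient finite type V, so that deletion
   stays inside one type; elements of V outside I and P play no role. An edge
   is the set of its two endpoints. *)
Record pgraph (V : finType) := PGraph {
  inner : {set V};
  pins : {set V};
  edges : {set {set V}} }.

Definition pinned_graph (V : finType) (G : pgraph V) : Prop :=
  [disjoint inner G & pins G] /\
  forall e, e \in edges G ->
    [/\ #|e| = 2%N, e \subset inner G :|: pins G
      & exists2 v, v \in e & v \in inner G].

Definition no_isolated_pin (V : finType) (G : pgraph V) : Prop :=
  forall x, x \in pins G -> exists2 e, e \in edges G & x \in e.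

Definition induced_edges (V : finType) (G : pgraph V) (A : {set V}) :=
  [set e in edges G | e \subset A].

Definition del_vertex (V : finType) (G : pgraph V) (v : V) : pgraph V :=
  PGraph (inner G :\ v) (pins G) [set e in edges G | v \notin e].

Definition del_edge (V : finType) (G : pgraph V) (e : {set V}) : pgraph V :=
  PGraph (inner G) (pins G) (edges G :\ e).

Definition degree (V : finType) (G : pgraph V) (v : V) : nat :=
  #|[set e in edges G | v \in e]|.

(* Rows are indexed by the edges, columns by the two coordinates of every v : V.
   For e = {v, w} the sum below has the single nonzero term p_v - p_w. Vertices
   not in the graph only contribute zero columns. *)
Definition rigidity_mx (R : realType) (V : finType) (E : {set {set V}})
    (p : V -> 'rV[R]_2) : 'M[R]_(#|E|, #|{: V * 'I_2}|) :=
  \matrix_(a, b)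
    let e : {set V} := enum_val a in
    let: (v, c) := (enum_val b : V * 'I_2) in
    if v \in e then \sum_(w in e) (p v 0 c - p w 0 c) else 0.

(* The positions of the vertices in P are fixed, the others vary. A minor is a
   polynomial in the coordinates that vary, and R is infinite, so that it is a
   nonzero polynomial iff some placement makes it nonzero. *)
Definition generic (R : realType) (V : finType) (E : {set {set V}})
    (P : {set V}) (p : V -> 'rV[R]_2) : Prop :=
  forall k (f : 'I_k -> 'I_#|E|) (g : 'I_k -> 'I_#|{: V * 'I_2}|),
    (exists2 q : V -> 'rV[R]_2, {in P, q =1 p}
       & \det (mxsub f g (rigidity_mx E q)) != 0) ->
    \det (mxsub f g (rigidity_mx E p)) != 0.

Definition generically_rigid (R : realType) (V : finType) (W : {set V})
    (E : {set {set V}}) : Prop :=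
  forall p : V -> 'rV[R]_2, generic E set0 p ->
    (\rank (rigidity_mx E p) + 3 = 2 * #|W|)%N.

Definition complete_edges (V : finType) (A : {set V}) : {set {set V}} :=
  [set e : {set V} | (e \subset A) && (#|e| == 2%N)].

(* The complete graph K_P is put on the pins together with m new vertices. It
   has to have at least two vertices: a single vertex does not fix a frame of
   reference. *)
Definition body_verts (V : finType) (G : pgraph V) (m : nat) :
    {set V + 'I_m} :=
  [set inl x | x in pins G] :|: [set inr j | j in [set: 'I_m]].

Definition with_body_verts (V : finType) (G : pgraph V) (m : nat) :
    {set V + 'I_m} :=
  [set inl x | x in inner G] :|: body_verts G m.

Definition with_body_edges (V : finType) (G : pgraph V) (m : nat) :
    {set {set V + 'I_m}} :=
  [set [set inl x | x in e] | e : {set V} in edges G]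
    :|: complete_edges (body_verts G m).

Definition pinned_isostatic (R : realType) (V : finType) (G : pgraph V) :
    Prop :=
  #|edges G| = (2 * #|inner G|)%N /\
  exists2 m, (2 <= #|body_verts G m|)%N
    & generically_rigid R (with_body_verts G m) (with_body_edges G m).

(* I' must be nonempty: I' = set0 would require 0 <= -1. *)
Definition minimal_pinned (V : finType) (G : pgraph V) : Prop :=
  forall I' P' : {set V}, I' \subset inner G -> P' \subset pins G ->
    I' :|: P' \proper inner G :|: pins G -> I' != set0 ->
    (#|induced_edges G (I' :|: P')| <= 2 * #|I'| - 1)%N.

(* A multigraph has edges K and endpoint map ends, so parallel edges are
   distinct elements of K with the same endpoints. The equalities and
   inequalities on cardinals are rearranged to avoid truncated subtraction. *)
Definition incident_verts (K W : finType) (ends : K -> {set W}) (F : {set K}) :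
    {set W} := \bigcup_(e in F) ends e.

Definition rigidity_circuit (K W : finType) (ends : K -> {set W})
    (C : {set K}) : Prop :=
  [/\ C != set0, (#|C| + 2 = 2 * #|incident_verts ends C|)%N
    & forall F : {set K}, F != set0 -> F \proper C ->
        (#|F| + 3 <= 2 * #|incident_verts ends F|)%N].

(* None is the vertex p* to which all pins are contracted. *)
Definition contract (V : finType) (G : pgraph V) (x : V) : option V :=
  if x \in pins G then None else Some x.

Definition contracted_ends (V : finType) (G : pgraph V) (e : {set V}) :
    {set option V} := [set contract G x | x in e].

Definition motion (R : realType) (V : finType) (G : pgraph V)
    (p u : V -> 'rV[R]_2) : Prop :=
  (forall x, x \in pins G -> u x = 0) /\
  forall x y, [set x; y] \in edges G ->
    (p x - p y) *m (u x - u y)^T = 0.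

(* The pins sit where p0 puts them. *)
Definition all_inner_move (R : realType) (V : finType) (G : pgraph V)
    (p0 : V -> 'rV[R]_2) : Prop :=
  forall p : V -> 'rV[R]_2, {in pins G, p =1 p0} ->
    generic (edges G) (pins G) p ->
    exists2 u : V -> 'rV[R]_2, motion G p u
      & forall v, v \in inner G -> u v != 0.

(* Main.v *)
Require Import Defs.
From mathcomp Require Import all_boot all_order all_algebra.
From mathcomp Require Import reals.
From mathcomp Require Import boolp zify ring.

(** Everything rests on a pinned version of Laman's theorem, for pins at
    arbitrary distinct positions: if the edge counts hold, then some placement
    of the inner vertices makes the rows of the rigidity matrix independent,
    even after one suitable column of a prescribed inner vertex w is erased, so
    that some motion moves w. Choose first a direction for every edge instead
    of a placement. The possible rows of an edge form a plane, so Rado's theorem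
    on independent representatives gives independent rows as soon as any set J
    of edges spans a space of dimension at least #|J|, and this follows from
    the counts on the classes of vertices that the span of J identifies. The
    same argument with one edge doubled and with the pins scaled by an
    unknown s shows that for suitable normals n_e the system
    n_e . (p_x - p_y) = 0 with the pins in place has a solution p without
    collapsed edges. Then p_x - p_y is a nonzero multiple of n_e turned by a
    right angle, and the rigidity matrix of p is as independent as the rows n_e.

    Minimality says that deleting a vertex or an edge leaves
    #|E(I' + P)| < 2 #|I'| for all nonempty I'; this strict count lets every
    inner vertex move, and a generic combination of these motions moves all of
    them. Conversely a proper set I' with #|E(I' + P)| = 2 #|I'| stays rigid when
    an inner vertex or an edge outside it is deleted. *)

Set Implicit Arguments.
Unset Strict Implicit.
Unset Printing Implicit Defensive.

Import Order.TTheory GRing.Theory Num.Theory.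
Local Open Scope ring_scope.

(** * Generic points and representatives *)

Section LinePoly.
Variables (R : numFieldType) (M : lmodType R).

(** Polynomiality along lines replaces multivariate polynomials: it is stable under sums and
    products and suffices to make finitely many functions nonzero at a common point. *)
Definition line_poly (f : M -> R) :=
  forall a b, exists h : {poly R}, forall t, f (a + t *: b) = h.[t].

Lemma line_poly_ext (f g : M -> R) : f =1 g -> line_poly f -> line_poly g.
Proof. by move=> fg fP a b; have [h hP] := fP a b; exists h => t; rewrite -fg. Qed.

Lemma line_poly_cst c : line_poly (fun=> c).
Proof. by move=> a b; exists c%:P => t; rewrite hornerC. Qed.

Lemma line_poly_add f g :
  line_poly f -> line_poly g -> line_poly (fun x => f x + g x).
Proof.
move=> fP gP a b; have [h hP] := fP a b; have [k kP] := gP a b.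
by exists (h + k) => t; rewrite hP kP hornerD.
Qed.

Lemma line_poly_mul f g :
  line_poly f -> line_poly g -> line_poly (fun x => f x * g x).
Proof.
move=> fP gP a b; have [h hP] := fP a b; have [k kP] := gP a b.
by exists (h * k) => t; rewrite hP kP hornerM.
Qed.

Lemma line_poly_sum (I : finType) (P : pred I) (f : I -> M -> R) :
  (forall i, line_poly (f i)) -> line_poly (fun x => \sum_(i | P i) f i x).
Proof.
move=> fP; elim: (index_enum I) => [|i s IHs].
  by apply: line_poly_ext (line_poly_cst 0) => x; rewrite big_nil.
case Pi: (P i); last by apply: line_poly_ext IHs => x; rewrite big_cons Pi.
by apply: line_poly_ext (line_poly_add (fP i) IHs) => x; rewrite big_cons Pi.
Qed.

Lemma line_poly_prod (I : finType) (f : I -> M -> R) :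
  (forall i, line_poly (f i)) -> line_poly (fun x => \prod_i f i x).
Proof.
move=> fP; elim: (index_enum I) => [|i s IHs].
  by apply: line_poly_ext (line_poly_cst 1) => x; rewrite big_nil.
by apply: line_poly_ext (line_poly_mul (fP i) IHs) => x; rewrite big_cons.
Qed.

Lemma line_poly_det n (A : M -> 'M[R]_n) :
  (forall i j, line_poly (fun x => A x i j)) ->
  line_poly (fun x => \det (A x)).
Proof.
move=> AP; apply: line_poly_sum => s.
by apply: line_poly_mul (line_poly_cst _) _; apply: line_poly_prod => i.
Qed.

Lemma line_poly_linear (f : M -> R) :
  (forall a t b, f (a + t *: b) = f a + t * f b) -> line_poly f.
Proof.
move=> fL a b; exists ((f a)%:P + 'X * (f b)%:P) => t.
by rewrite fL !hornerE.
Qed.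

Lemma poly_nonroot (h : {poly R}) : h != 0 -> exists t, h.[t] != 0.
Proof.
move=> h0; pose s : seq R := [seq i%:R | i <- iota 0 (size h)].
have us : uniq s.
  by rewrite map_inj_uniq ?iota_uniq // => i j /eqP; rewrite eqr_nat => /eqP.
case: (altP (@allP _ (root h) s)) => [/allP hs | /allPn[t _ ht]]; last by exists t.
by have := max_poly_roots h0 hs us; rewrite size_map size_iota ltnn.
Qed.

(** On the line through [a] and [b] both functions become nonzero polynomials in one parameter, and
    their product has a nonroot. *)
Lemma line_poly_nonzero2 f g a b :
  line_poly f -> line_poly g -> f a != 0 -> g b != 0 ->
  exists2 c, f c != 0 & g c != 0.
Proof.
move=> fP gP fa gb.
have [h hP] := fP a (b - a); have [k kP] := gP a (b - a).
have h0 : h != 0.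
  by apply: contraNneq fa => h0; have := hP 0; rewrite h0 horner0 scale0r addr0 => ->.
have k0 : k != 0.
  apply: contraNneq gb => k0; have := kP 1.
  by rewrite k0 horner0 scale1r addrC subrK => ->.
have [t] : exists t, (h * k).[t] != 0 by apply: poly_nonroot; rewrite mulf_neq0.
rewrite hornerM mulf_eq0 negb_or -hP -kP => /andP[ft gt].
by exists (a + t *: (b - a)).
Qed.

Lemma line_poly_common (I : finType) (f : I -> M -> R) :
  (forall i, line_poly (f i)) -> (forall i, exists x, f i x != 0) ->
  exists x, forall i, f i x != 0.
Proof.
move=> fP f0.
suff [x xP]: exists x, forall i, i \in enum I -> f i x != 0.
  by exists x => i; rewrite xP // mem_enum.
suff: exists x, \prod_(i <- enum I) f i x != 0.
  by case=> x; rewrite prodf_seq_neq0 => /allP xP; exists x => i /xP.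
have prodP s : line_poly (fun x => \prod_(i <- s) f i x).
  elim: s => [|i s IHs].
    by apply: line_poly_ext (line_poly_cst 1) => x; rewrite big_nil.
  by apply: line_poly_ext (line_poly_mul (fP i) IHs) => x; rewrite big_cons.
elim: (enum I) => [|i s [x xP]]; first by exists 0; rewrite big_nil oner_neq0.
have [y yP] := f0 i.
have [z z1 z2] := line_poly_nonzero2 (fP i) (prodP s) yP xP.
by exists z; rewrite big_cons mulf_neq0.
Qed.

End LinePoly.

(** * Minors, ranks and independent representatives *)

Section Rank.
Variable F : fieldType.

Lemma nonzero_minor m n (A : 'M[F]_(m, n)) :
  exists (f : 'I_(\rank A) -> 'I_m) (g : 'I_(\rank A) -> 'I_n),
    \det (mxsub f g A) != 0.
Proof.
have rB : row_full (rowsub (maxrankfun A) A)^T.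
  by rewrite /row_full mxrank_tr; exact: maxrowsub_free.
exists (maxrankfun A), (fullrankfun rB).
have := fullrowsub_unit rB; rewrite unitmxE unitfE -det_tr.
by congr (\det _ != 0); apply/matrixP=> i j; rewrite !mxE.
Qed.

Lemma minor_leq_rank k m n (A : 'M[F]_(m, n)) (f : 'I_k -> 'I_m)
    (g : 'I_k -> 'I_n) :
  \det (mxsub f g A) != 0 -> (k <= \rank A)%N.
Proof.
rewrite -unitfE -unitmxE => /mxrank_unit rk.
have eA : mxsub f g A = rowsub f 1%:M *m (A *m colsub g 1%:M).
  by rewrite -{1}[A]mulmx1 mxsub_mul rowsubE mulmxA.
rewrite eA in rk; rewrite -{1}rk.
exact: leq_trans (mxrankM_maxr _ _) (mxrankM_maxl _ _).
Qed.

(* Rado's theorem for subspaces, modulo B. As in the Halmos-Vaughan proof of Hall's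
   theorem, either a proper subfamily is tight and is treated first, or any
   vector outside B represents one A i. *)
Lemma rado_relative (T : finType) n (A : T -> 'M[F]_n) (J0 : {set T})
    (B : 'M[F]_n) :
  (forall J : {set T}, J \subset J0 ->
     (#|J| + \rank B <= \rank (B + \sum_(i in J) A i))%N) ->
  exists x : T -> 'rV[F]_n, (forall i, i \in J0 -> (x i <= A i)%MS) /\
    \rank (B + \sum_(i in J0) <<x i>>)%MS = (#|J0| + \rank B)%N.
Proof.
have [k] := ubnP #|J0|; elim: k => // k IHk in J0 B *; rewrite ltnS => leJ0k hall.
have [->|[i0 i0J0]] := set_0Vmem J0.
  by exists (fun=> 0); split=> [i|]; rewrite ?inE // big_set0 cards0 addsmx0.
have sumJU (X : T -> 'M[F]_n) (J K : {set T}) :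
    (\sum_(i in (J :|: K)%SET) X i <= \sum_(i in J) X i + \sum_(i in K) X i)%MS.
  apply/sumsmx_subP=> i; rewrite inE => /orP[iJ|iK].
    by apply: submx_trans (addsmxSl _ _); apply: (sumsmx_sup i).
  by apply: submx_trans (addsmxSr _ _); apply: (sumsmx_sup i).
(* Representatives for [J] modulo [B], followed by representatives for the rest modulo the span so
   far, serve for [J0]. *)
have glue (J : {set T}) (x y : T -> 'rV[F]_n) : J \subset J0 ->
    (forall i, i \in J -> (x i <= A i)%MS) ->
    \rank (B + \sum_(i in J) <<x i>>)%MS = (#|J| + \rank B)%N ->
    (forall i, i \in J0 :\: J -> (y i <= A i)%MS) ->
    \rank (B + \sum_(i in J) <<x i>> + \sum_(i in (J0 :\: J)%SET) <<y i>>)%MS =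
      (#|J0 :\: J| + \rank (B + \sum_(i in J) <<x i>>)%MS)%N ->
    exists x : T -> 'rV[F]_n, (forall i, i \in J0 -> (x i <= A i)%MS) /\
      \rank (B + \sum_(i in J0) <<x i>>)%MS = (#|J0| + \rank B)%N.
  move=> sJ xA rx yA ry; exists (fun i => if i \in J then x i else y i); split.
    by move=> i iJ0; case: ifP => iJ; [exact: xA | apply: yA; rewrite inE iJ].
  have <- : (#|J0 :\: J| + (#|J| + \rank B) = #|J0| + \rank B)%N.
    by rewrite addnA addnC cardsD (setIidPr sJ) subnK ?subset_leq_card // addnC.
  rewrite -rx -ry; apply/eqP; rewrite eqn_leq; apply/andP; split.
    apply: mxrankS; rewrite -addsmxA addsmxS //.
    apply/sumsmx_subP => i iJ0; case: ifP => iJ.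
      by apply: submx_trans (addsmxSl _ _); apply: (sumsmx_sup i).
    apply: submx_trans (addsmxSr _ _); apply: (sumsmx_sup i) => //.
    by rewrite inE iJ.
  apply: mxrankS; rewrite -addsmxA addsmxS // addsmx_sub.
  apply/andP; split; apply/sumsmx_subP => i.
    by move=> iJ; apply: (sumsmx_sup i); rewrite ?(subsetP sJ) // iJ.
  rewrite inE => /andP[/negbTE iJ iJ0].
  by apply: (sumsmx_sup i); rewrite // iJ.
case: (boolP [exists J : {set T}, [&& J \proper J0, J != set0 &
    (\rank (B + \sum_(i in J) A i)%MS <= #|J| + \rank B)%N]]).
  case/existsP=> J /and3P[pJ Jn0 tJ]; have sJ := proper_sub pJ.
  have [|K sK|x [xA rx]] := IHk J B.
  - by apply: leq_trans (proper_card pJ) leJ0k.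
  - by apply: hall; apply: subset_trans sJ.
  have sxA : (B + \sum_(i in J) <<x i>> <= B + \sum_(i in J) A i)%MS.
    rewrite addsmxS //; apply/sumsmx_subP => i iJ.
    by rewrite genmxE; apply: (sumsmx_sup i); rewrite ?xA.
  (* Tightness makes the two spaces equal, so the condition for [K :|: J] becomes the condition for
     [K] modulo the enlarged space. *)
  have eqA : (B + \sum_(i in J) A i <= B + \sum_(i in J) <<x i>>)%MS.
    by rewrite -(geq_leqif (mxrank_leqif_sup sxA)) rx.
  have [||y [yA ry]] := IHk (J0 :\: J) (B + \sum_(i in J) <<x i>>)%MS.
  - rewrite (leq_trans _ leJ0k) // cardsD (setIidPr sJ).
    by rewrite ltn_subrL !card_gt0 Jn0; apply/set0Pn; exists i0.
  - move=> K sK; rewrite rx addnA.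
    have dKJ : [disjoint K & J] by move: sK; rewrite subsetD => /andP[].
    have cKJ : #|K :|: J| = (#|K| + #|J|)%N.
      by have := cardsUI K J; rewrite (disjoint_setI0 dKJ) cards0 addn0.
    rewrite -cKJ; have sKJ : K :|: J \subset J0.
      by rewrite subUset sJ (subset_trans sK) ?subsetDl.
    apply: leq_trans (hall _ sKJ) _; apply: mxrankS.
    rewrite addsmx_sub (submx_trans (addsmxSl _ _) (addsmxSl _ _)) /=.
    apply: submx_trans (sumJU A K J) _; rewrite addsmx_sub addsmxSr /=.
    apply: submx_trans (addsmxSl _ _).
    by apply: submx_trans eqA; exact: addsmxSr.
  exact: (glue J x y).
rewrite negb_exists => /forallP nt.
have /row_subPn[j gj] : ~~ (A i0 <= B)%MS.
  have := hall [set i0]; rewrite sub1set i0J0 cards1 big_set1 => /(_ isT).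
  by rewrite add1n ltn_neqAle => /andP[nBA _]; apply: contra nBA => /addsmx_idPl ->.
pose g := row j (A i0).
have rBg : \rank (B + g)%MS = (1 + \rank B)%N.
  apply/eqP; rewrite eqn_leq; apply/andP; split.
    rewrite addnC (leq_trans (mxrank_adds_leqif _ _)) // leq_add2l.
    exact: rank_leq_row.
  have sB := addsmxSl B g.
  by rewrite add1n ltnNge (geq_leqif (mxrank_leqif_sup sB)) addsmx_sub submx_refl.
have [||y [yA ry]] := IHk (J0 :\ i0) (B + <<g>>)%MS.
- by rewrite (leq_trans _ leJ0k) // (cardsD1 i0 J0) i0J0.
- move=> K sK; have rB' : \rank (B + <<g>>)%MS = (1 + \rank B)%N.
    by rewrite -rBg (adds_eqmx (eqmx_refl B) (genmxE g)).
  have [->|K0] := eqVneq K set0; first by rewrite big_set0 cards0 addsmx0.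
  have pK : K \proper J0.
    by apply: sub_proper_trans sK (properD1 i0J0).
  (* As [K] is not tight, it can spare the one dimension that [g] adds to [B]. *)
  have := nt K; rewrite pK K0 /= -ltnNge rB' addnA addn1 => ltK.
  apply: leq_trans ltK _; apply: mxrankS.
  by apply: addsmxS => //; exact: addsmxSl.
apply: (glue [set i0] (fun=> g) y); rewrite ?sub1set ?big_set1 ?cards1 //.
- by move=> i; rewrite inE => /eqP->; exact: row_sub.
- by rewrite -rBg (adds_eqmx (eqmx_refl B) (genmxE g)).
Qed.

End Rank.

(** The rank is lower semicontinuous: [f] is a maximal nonzero minor at [x0], and the rank cannot
    drop where it stays nonzero. *)
Lemma rank_line_open (R : numFieldType) (M : lmodType R) m n
    (A : M -> 'M[R]_(m, n)) (x0 : M) :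
  (forall i j, line_poly (fun x => A x i j)) ->
  exists2 f : M -> R, line_poly f & f x0 != 0 /\
    forall x, f x != 0 -> (\rank (A x0) <= \rank (A x))%N.
Proof.
move=> AP; have [f [g nz]] := nonzero_minor (A x0).
exists (fun x => \det (mxsub f g (A x))).
  by apply: line_poly_det => i j; apply: line_poly_ext (AP (f i) (g j)) => x; rewrite mxE.
by split=> // x; exact: minor_leq_rank.
Qed.

(** * Direction networks *)

Lemma rank_sum_rows (F : fieldType) (T : finType) (P : pred T) n
    (x : T -> 'rV[F]_n) : (\rank (\sum_(i | P i) <<x i>>)%MS <= #|P|)%N.
Proof.
rewrite -sum1_card; apply: leq_trans (mxrank_sum_leqif _) _.
by apply: leq_sum => i _ /=; rewrite genmxE; exact: rank_leq_row.
Qed.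

(** The dimension formula leaves no slack, so the rows of [A] are independent and their span meets
    [U] only in 0. *)
Lemma independent_mod (F : fieldType) l m n (U : 'M[F]_(l, n))
    (A : 'M[F]_(m, n)) (r : nat) (a : 'rV_m) :
  (\rank U <= r)%N -> (r + m <= \rank (U + A)%MS)%N -> (a *m A <= U)%MS -> a = 0.
Proof.
move=> rU rUA aU; have rA := rank_leq_row A.
have [fA cap0] : row_free A /\ \rank (U :&: A)%MS = 0%N.
  have : \rank (U :&: A)%MS = 0%N /\ \rank A = m.
    have := mxrank_sum_cap U A.
    move: (\rank _) (\rank _) (\rank _) (\rank _) rU rUA rA => x y z t.
    by clear; lia.
  by case=> -> /eqP.
apply: (row_free_inj fA); rewrite mul0mx; apply/eqP.
rewrite -submx0; have /eqP := cap0; rewrite mxrank_eq0 -submx0.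
by apply: submx_trans; rewrite sub_capmx aU submxMl.
Qed.

Lemma card_fibers (T U : finType) (A : {set T}) (f : T -> U) :
  #|A| = \sum_t #|[set k in A | f k == t]|.
Proof.
rewrite -sum1_card (partition_big f predT) //=; apply: eq_bigr => t _.
by rewrite -sum1_card; apply: eq_bigl => k; rewrite inE.
Qed.

Section DirectionNetwork.
Variables (R : numFieldType) (V : finType) (I : {set V}) (w : V) (m : nat).
Variables (src tgt : 'I_m -> V) (pos : V -> 'rV[R]_2).

Local Notation N := #|{: option (V * 'I_2)}|.

(* Columns are the coordinates of the vertices and, at None, the scale s: a pin
   x sits at s * pos x. *)
Definition unit_row (i : option (V * 'I_2)) : 'rV[R]_N :=
  delta_mx 0 (enum_rank i).
Local Notation vr v c := (unit_row (Some (v, c))).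
Local Notation sc := (unit_row None).

(** Its row space consists of the rows of all equations n . (p_src - p_tgt) = 0, for arbitrary n. *)
Definition edge_space (k : 'I_m) : 'M[R]_(2, N) :=
  \matrix_(c < 2) (vr (src k) c - vr (tgt k) c).

(** These equations place every vertex outside [I] at the scale times its prescribed position. *)
Definition pin_space : 'M[R]_N :=
  (\sum_(i : V * 'I_2 | i.1 \notin I) <<unit_row (Some i) - pos i.1 0 i.2 *: sc>>)%MS.

Definition spanned (X : {set V}) : {set 'I_m} :=
  [set k | (src k \in X) && (tgt k \in X)].

Lemma rank_pin_space : (\rank pin_space <= 2 * #|~: I|)%N.
Proof.
apply: leq_trans (rank_sum_rows _ _) _.
rewrite mulnC -[X in (_ * X)%N](card_ord 2) -cardsT -cardsX.
by apply: subset_leq_card; apply/subsetP=> -[v c]; rewrite !inE /= andbT.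
Qed.

Lemma pin_row_sub v c : v \notin I ->
  (vr v c - pos v 0 c *: sc <= pin_space)%MS.
Proof. by move=> vI; apply: (sumsmx_sup (v, c)); rewrite ?genmxE. Qed.

Hypothesis src_neq_tgt : forall k, src k != tgt k.
Hypothesis edge_inner : forall k, (src k \in I) || (tgt k \in I).
(** The term for [w] reserves a dimension for moving [w]; the surplus in [count_one_pin] allows an
    edge to be doubled where all pins of [X] sit at one place. *)
Hypothesis count_pinned : forall X : {set V},
  (#|spanned X| + (w \in X) <= 2 * #|X :&: I|)%N.
Hypothesis count_one_pin : forall X : {set V}, X :&: I != set0 ->
  {in X :\: I &, forall x y, pos x = pos y} ->
  (#|spanned X| + 1 <= 2 * #|X :&: I|)%N.
Hypothesis count_inner : forall X : {set V}, X \subset I -> (2 <= #|X|)%N ->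
  (#|spanned X| + 3 <= 2 * #|X|)%N.

(** * Dimension count for the span of pin and edge equations *)

Section Count.
Variables (l : nat) (Y : 'M[R]_(l, N)) (J : {set 'I_m}) (strict : bool).
Hypothesis pinY : (pin_space <= Y)%MS.
Hypothesis edgeY : forall k, k \in J -> (edge_space k <= Y)%MS.
Hypothesis strictY : strict ->
  if (sc <= Y)%MS then forall c, (vr w c <= Y)%MS else J != set0.

(** Vertices are identified when their coordinates agree modulo [Y]. A class is pinned when [Y]
    fixes its position up to the scale. *)
Let eqv x y := [forall c, vr x c - vr y c <= Y]%MS.
Let rep v := odflt v [pick x | eqv x v].
Let pinned v := [forall c, vr v c <= Y + sc]%MS.
Let cls t := [set v | rep v == t].
Let reps := [set t | (rep t == t) && ~~ pinned t].

Let eqv_refl x : eqv x x.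
Proof. by apply/forallP=> c; rewrite subrr sub0mx. Qed.

Let eqv_sym x y : eqv x y -> eqv y x.
Proof. by move/forallP=> e; apply/forallP=> c; rewrite -opprB eqmx_opp. Qed.

Let eqv_trans x y z : eqv x y -> eqv y z -> eqv x z.
Proof.
move=> /forallP e /forallP f; apply/forallP=> c.
by rewrite -(subrK (vr y c) (vr x c)) -addrA addmx_sub.
Qed.

Let repP v : eqv (rep v) v.
Proof. by rewrite /rep; case: pickP => [x //|]; rewrite eqv_refl. Qed.

Let rep_eq x y : eqv x y -> rep x = rep y.
Proof.
move=> exy; rewrite /rep; have /eq_pick -> : eqv^~ x =1 eqv^~ y.
  move=> u; apply/idP/idP=> h; first exact: eqv_trans exy.
  exact: eqv_trans h (eqv_sym exy).
by case: pickP => [u|/(_ y)]; last by rewrite eqv_refl.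
Qed.

Let rep_rep v : rep (rep v) = rep v.
Proof. exact: rep_eq (repP v). Qed.

Let eqv_edge k : k \in J -> eqv (src k) (tgt k).
Proof.
move=> kJ; apply/forallP=> c; apply: submx_trans (edgeY kJ).
by rewrite -[X in (X <= _)%MS](rowK (fun c => vr (src k) c - vr (tgt k) c)) row_sub.
Qed.

Let pinned_rep v : pinned v -> pinned (rep v).
Proof.
move=> /forallP p; apply/forallP=> c.
rewrite -(subrK (vr v c) (vr _ c)) addmx_sub //.
by apply: submx_trans (addsmxSl _ _); have /forallP := repP v.
Qed.

Let pin_mod v c : v \notin I -> (vr v c - pos v 0 c *: sc <= Y)%MS.
Proof. by move=> vI; apply: submx_trans pinY; exact: pin_row_sub. Qed.

Let pinned_pin v : v \notin I -> pinned v.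
Proof.
move=> vI; apply/forallP=> c; rewrite -(subrK (pos v 0 c *: sc) (vr v c)).
by rewrite addmx_sub_adds ?pin_mod ?scalemx_sub.
Qed.

(** Together with [Y] and the scale, the coordinates of the unpinned representatives generate the
    whole space, of dimension [2 * #|V| + 1]. *)
Let rank_reps : (2 * #|V| + (sc <= Y)%MS <= \rank Y + 2 * #|reps|)%N.
Proof.
pose Z := (\sum_(i in setX reps [set: 'I_2]) <<unit_row (Some i)>>)%MS.
have full : (1%:M <= Y + sc + Z)%MS.
  apply/row_subP => j; rewrite rowE mulmx1 -(enum_valK j).
  have repY v c : (vr (rep v) c <= Y + sc + Z)%MS.
    have [pv|npv] := boolP (pinned (rep v)).
      by apply: submx_trans (addsmxSl _ _); have /forallP := pv.
    apply: submx_trans (addsmxSr _ _); apply: (sumsmx_sup (rep v, c)).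
      by rewrite in_setX !inE /= rep_rep eqxx npv.
    by rewrite genmxE.
  case: (enum_val j) => [[v c]|]; last first.
    by apply: submx_trans (addsmxSl _ _); exact: addsmxSr.
  rewrite -/(unit_row _) -(subrK (vr (rep v) c) (vr v c)) addmx_sub //.
  apply: submx_trans (addsmxSl _ _); apply: submx_trans (addsmxSl _ _).
  by have /forallP := eqv_sym (repP v).
have rZ : (\rank Z <= 2 * #|reps|)%N.
  apply: leq_trans (rank_sum_rows _ _) _.
  by rewrite cardsX cardsT card_ord mulnC.
have rYs : (\rank (Y + sc)%MS + (sc <= Y)%MS <= \rank Y + 1)%N.
  have [/addsmx_idPl e|_] := boolP (sc <= Y)%MS; first by rewrite e.
  rewrite addn0 (leq_trans (mxrank_adds_leqif _ _)) // leq_add2l.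
  exact: rank_leq_row.
have cN : (N = 2 * #|V| + 1)%N by rewrite card_option card_prod card_ord mulnC addn1.
have := mxrankS full; rewrite mxrank1 [X in (X <= _)%N]cN.
have : (\rank (Y + sc + Z)%MS <= \rank (Y + sc)%MS + \rank Z)%N.
  by rewrite mxrank_adds_leqif.
lia.
Qed.

Let count_cls t (t0 : V) :
  (strict -> if (sc <= Y)%MS then t0 = rep w
             else exists2 k, k \in J & t0 = rep (src k)) ->
  (#|[set k in J | rep (src k) == t]| + (strict && (t == t0)) +
     2 * (t \in reps) <= 2 * #|cls t :&: I|)%N.
Proof.
move=> t0P; set Jt := [set k in J | _].
have sJt : Jt \subset spanned (cls t).
  apply/subsetP=> k; rewrite !inE => /andP[kJ /eqP <-].
  by rewrite eqxx /= (rep_eq (eqv_edge kJ)).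
have cJt := subset_leq_card sJt.
have edge_cls : strict && (t == t0) -> ~~ (sc <= Y)%MS ->
    exists2 k, k \in J & (k \in spanned (cls t)).
  move=> /andP[/t0P] + /eqP -> => /[swap] /negbTE-> [k kJ ->].
  exists k; rewrite // !inE eqxx /=; apply/eqP; apply: rep_eq.
  exact: eqv_sym (eqv_edge kJ).
have wY : strict && (t == t0) -> (sc <= Y)%MS -> w \in cls t /\ pinned t.
  move=> /andP[st /eqP->] sY; have := strictY st; have := t0P st.
  rewrite sY => -> wY; split; first by rewrite inE.
  by apply: pinned_rep; apply/forallP=> c; apply: submx_trans (addsmxSl _ _).
have [tR|tR] := boolP (t \in reps).
  move: tR; rewrite inE => /andP[/eqP rt npt].
  have sI : cls t \subset I.
    apply/subsetP=> v; rewrite inE => /eqP rv; apply: contraR npt => vI.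
    by rewrite -rv pinned_rep // pinned_pin.
  have tc : t \in cls t by rewrite inE rt.
  rewrite (setIidPl sI); have [c2|] := leqP 2 #|cls t|.
    move: cJt (count_inner sI c2); move: #|Jt| #|spanned _| #|cls t| => a b d.
    by case: (strict && _); clear; lia.
  rewrite (cardsD1 t) tc add1n ltnS ltnS leqn0 cards_eq0 => /eqP c0.
  have ct v : v \in cls t -> v = t.
    move=> vc; have := in_set0 v; rewrite -c0 in_setD1 vc andbT.
    by move/negbFE/eqP.
  have s0 : spanned (cls t) = set0.
    apply/setP=> k; rewrite in_set0; apply: negbTE.
    rewrite inE; apply: contra (src_neq_tgt k) => /andP[/ct-> /ct->] //.
  rewrite c0 cards0; move: cJt; rewrite s0 cards0 leqn0 => /eqP->.
  case E: (_ && _) => //=; have [sY|nsY] := boolP (sc <= Y)%MS.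
    by have [_ pt] := wY E sY; rewrite pt in npt.
  by have [k _] := edge_cls E nsY; rewrite s0 inE.
rewrite muln0 addn0; case E: (_ && _); last first.
  rewrite addn0 (leq_trans cJt) //.
  by apply: leq_trans (count_pinned _); exact: leq_addr.
have [sY|nsY] := boolP (sc <= Y)%MS.
  have [wc _] := wY E sY.
  by apply: leq_trans (count_pinned (cls t)); rewrite wc leq_add2r.
have [k kJ ks] := edge_cls E nsY.
apply: leq_trans (count_one_pin _ _); first by rewrite leq_add2r.
  apply/set0Pn; move: ks; rewrite inE => /andP[sk tk].
  have [h|h] := orP (edge_inner k); [exists (src k) | exists (tgt k)].
    by rewrite inE sk.
  by rewrite inE tk.
move=> x y; rewrite !in_setD !(inE, in_setD) => /andP[xI /eqP rx] /andP[yI /eqP ry].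
(* Two pins of one class at different positions would put a nonzero multiple of the scale into
   [Y]. *)
apply/rowP=> c; apply/eqP; apply: contraR nsY => nxy.
have exy : eqv x y by apply: eqv_trans (eqv_sym (repP x)) _; rewrite rx -ry repP.
rewrite -subr_eq0 in nxy; rewrite -(eqmx_scale _ nxy) scalerBl.
have -> : pos x 0 c *: sc - pos y 0 c *: sc = (vr x c - vr y c) -
   (vr x c - pos x 0 c *: sc) + (vr y c - pos y 0 c *: sc).
  by rewrite opprB (addrC (vr x c - vr y c)) !addrA !subrK.
apply: addmx_sub (pin_mod _ yI); apply: addmx_sub; last first.
  by rewrite eqmx_opp pin_mod.
by have /forallP := exy.
Qed.

(** Summing [count_cls] over the classes bounds the number of unpinned ones, and [rank_reps] turns
    this into a rank bound. The term [strict] is the surplus needed for the coordinates of [w] or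
    for a doubled edge. *)
Lemma rank_count :
  (2 * #|~: I| + #|J| + (sc <= Y)%MS + strict <= \rank Y)%N.
Proof.
have [t0 t0P] : exists t0, strict -> if (sc <= Y)%MS then t0 = rep w
             else exists2 k, k \in J & t0 = rep (src k).
  case: (boolP (sc <= Y)%MS) => sY; first by exists (rep w).
  have [st|nst] := boolP strict; last by exists w.
  have := strictY st; rewrite (negbTE sY) => /set0Pn[k kJ].
  by exists (rep (src k)) => _; exists k.
have := @leq_sum V (index_enum V) predT _ _ (fun t _ => @count_cls t t0 t0P).
rewrite !big_split /= -(card_fibers J (rep \o src)) !sum_nat_const !muln0.
have -> : (\sum_i #|cls i :&: I| = #|I|)%N.
  rewrite (card_fibers I rep); apply: eq_bigr => t _; apply: eq_card => v.
  by rewrite !inE andbC.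
have -> : (\sum_i (strict && (i == t0)) = strict)%N.
  rewrite (bigD1 t0) //= eqxx andbT big1 ?addn0 // => i /negbTE->.
  by rewrite andbF.
have -> : (\sum_i (i \in reps) = #|reps|)%N.
  by rewrite -sum1_card [RHS]big_mkcond; apply: eq_bigr => i _; case: (_ \in _).
have := rank_reps; have := cardsC I.
move: #|reps| #|I| #|~: I| #|V| #|J| (\rank Y) (nat_of_bool (_ <= _)%MS).
by clear; lia.
Qed.

End Count.

(** * Generic normals *)

Definition normal_rows (n : 'M[R]_(m, 2)) : 'M[R]_(m, N) :=
  \matrix_(k < m) (row k n *m edge_space k).

Lemma normal_rows_line_poly (i : 'I_m) (j : 'I_N) :
  line_poly (fun n => normal_rows n i j).
Proof.
apply: line_poly_linear => a t b.
by rewrite !mxE !big_ord_recl !big_ord0 !mxE; ring.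
Qed.

(** Rado's theorem is applied to the edge spaces and to [C], indexed by [None]; the hypotheses are
    its condition without and with [C]. A representative in [edge_space k] amounts to a normal for
    edge [k]. *)
Lemma rado_normals (B : 'M[R]_N) (C : 'M[R]_(2, N)) :
  (forall J : {set 'I_m}, #|J| + \rank B <=
     \rank (B + \sum_(k in J) <<edge_space k>>)%MS)%N ->
  (forall J : {set 'I_m}, #|J| + 1 + \rank B <=
     \rank (B + \sum_(k in J) <<edge_space k>> + C)%MS)%N ->
  exists n (g : 'rV[R]_N), (g <= C)%MS /\
    (\rank B + m + 1 <= \rank (col_mx (col_mx B g) (normal_rows n)))%N.
Proof.
move=> hB hC.
pose A (o : option 'I_m) := if o is Some k then <<edge_space k>>%MS else <<C>>%MS.
have hA (J : {set option 'I_m}) : J \subset [set: option 'I_m] ->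
    (#|J| + \rank B <= \rank (B + \sum_(o in J) A o)%MS)%N.
  move=> _; pose K := [set k | Some k \in J].
  have cJ : #|J| = ((None \in J) + #|K|)%N.
    rewrite (cardsD1 None) -(card_imset K (@Some_inj _)); congr (_ + _)%N.
    apply: eq_card => -[k|]; rewrite !inE /=; last first.
      by apply/esym/negbTE/imsetP=> -[].
    apply/idP/imsetP => [kJ|[k' + [->]]]; last by rewrite inE.
    by exists k; rewrite ?inE.
  have sK : (\sum_(k in K) <<edge_space k>> <= \sum_(o in J) A o)%MS.
    apply/sumsmx_subP=> k; rewrite inE => kJ.
    exact: (sumsmx_sup (Some k)).
  rewrite cJ; have [nJ|nJ] := boolP (None \in J).
    rewrite (addnC _ #|K|) (leq_trans (hC K)) //; apply: mxrankS.
    rewrite addsmx_sub addsmxS //=; apply: submx_trans (addsmxSr _ _).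
    by apply: (sumsmx_sup None); rewrite ?genmxE.
  rewrite add0n (leq_trans (hB K)) //; apply: mxrankS.
  by rewrite addsmxS.
have [x [xA rx]] := rado_relative hA.
have nP k : exists n : 'rV_2, x (Some k) = n *m edge_space k.
  by apply/submxP; have := xA (Some k); rewrite inE genmxE; exact.
have [n nE] := fin_all_exists nP.
exists (\matrix_k n k), (x None); split.
  by have := xA None; rewrite inE genmxE; exact.
have -> : (\rank B + m + 1 = #|[set: option 'I_m]| + \rank B)%N.
  have -> : #|[set: option 'I_m]| = m.+1 by rewrite cardsT card_option card_ord.
  by rewrite addn1 addSn addnC.
rewrite -rx; apply: mxrankS; rewrite addsmx_sub; apply/andP; split.
  by rewrite -addsmxE; apply: submx_trans (addsmxSl _ _); rewrite -addsmxE addsmxSl.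
apply/sumsmx_subP=> -[k|] _; rewrite genmxE -addsmxE; last first.
  by apply: submx_trans (addsmxSl _ _); rewrite -addsmxE addsmxSr.
apply: submx_trans (addsmxSr _ _).
have -> : x (Some k) = row k (normal_rows (\matrix_k n k)).
  by rewrite /normal_rows !rowK -nE.
exact: row_sub.
Qed.

Lemma rank_base (B : 'M[R]_N) (s : bool) : (pin_space <= B)%MS ->
  (s -> sc <= B)%MS -> (2 * #|~: I| + s <= \rank B)%N.
Proof.
move=> pB sB; have := @rank_count _ B set0 false pB.
rewrite cards0 !addn0 => /(_ _ _)/(leq_trans _)-> //.
  by rewrite leq_add2l; case: s sB => // ->.
by move=> k; rewrite inE.
Qed.

(** Each requirement is met by some normals and persists where a certain minor is nonzero, so a
    common choice meets all of them. The first will provide the column of [w] to erase; the one for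
    [e] treats [e] as doubled, to keep it from collapsing. *)
Lemma generic_normals : exists n,
  (exists2 g : 'rV[R]_N, (g <= \matrix_(c < 2) vr w c)%MS &
    (2 * #|~: I| + 1 + m + 1 <=
     \rank (col_mx (col_mx (pin_space + sc)%MS g) (normal_rows n)))%N) /\
  forall e, exists2 g : 'rV[R]_N, (g <= edge_space e)%MS &
    (2 * #|~: I| + m + 1 <=
     \rank (col_mx (col_mx pin_space g) (normal_rows n)))%N.
Proof.
pose B (o : option 'I_m) := if o is None then (pin_space + sc)%MS else pin_space.
pose C o := if o is Some e then edge_space e else \matrix_(c < 2) vr w c.
have pinB o : (pin_space <= B o)%MS by case: o => [e|] //=; exact: addsmxSl.
have wC c (l : nat) (Y : 'M_(l, N)) : (C None <= Y)%MS -> (vr w c <= Y)%MS.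
  by move/row_subP/(_ c); rewrite rowK.
have rB o : (\rank (B o) <= 2 * #|~: I| + (o == None))%N.
  case: o => [e|] /=; first by rewrite addn0 rank_pin_space.
  rewrite (leq_trans (mxrank_adds_leqif _ _)) // leq_add ?rank_pin_space //.
  exact: rank_leq_row.
have edgeY (J : {set 'I_m}) k l (Y : 'M_(l, N)) : k \in J ->
    (\sum_(k in J) <<edge_space k>> <= Y)%MS -> (edge_space k <= Y)%MS.
  move=> kJ; apply: submx_trans.
  by apply: (sumsmx_sup k); rewrite ?genmxE.
have /fin_all_exists[f fP] : forall o, exists ng : 'M[R]_(m, 2) * 'rV[R]_N,
    (ng.2 <= C o)%MS /\ (\rank (B o) + m + 1 <=
      \rank (col_mx (col_mx (B o) ng.2) (normal_rows ng.1)))%N.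
  move=> o; have [J|J|n [g h]] := @rado_normals (B o) (C o).
  - apply: leq_trans (leq_add (leqnn _) (rB o)) _.
    have := @rank_count _ (B o + \sum_(k in J) <<edge_space k>>)%MS J false.
    move=> /(_ _ _ _)/(leq_trans _)-> //.
    + rewrite addn0 addnCA addnA leq_add2l.
      case: o => [e|] //=; rewrite lt0b; apply: submx_trans (addsmxSl _ _).
      exact: addsmxSr.
    + exact: submx_trans (pinB o) (addsmxSl _ _).
    by move=> k kJ; apply: edgeY kJ (addsmxSr _ _).
  - apply: leq_trans (leq_add (leqnn _) (rB o)) _.
    case: o => [e|] /=; last first.
      set Y := (_ + \matrix_(c < 2) _)%MS.
      have sY : (sc <= Y)%MS.
        do 2!apply: submx_trans (addsmxSl _ _); exact: addsmxSr.
      have := @rank_count _ Y J true; rewrite sY => /(_ _ _ _)/(leq_trans _)-> //.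
      + move: #|J| #|~: I|; clear; lia.
      + by do 3!apply: submx_trans (addsmxSl _ _).
      + by move=> k kJ; apply: edgeY kJ _; apply: submx_trans (addsmxSl _ _); exact: addsmxSr.
      by move=> _ c; apply: wC; exact: addsmxSr.
    set Y := (_ + _)%MS.
    pose J' := e |: J.
    (* The extra dimension for the doubled edge comes from the term for [sc] if [Y] contains the
       scale, and from [strict] otherwise. *)
    have := @rank_count _ Y J' (~~ (sc <= Y)%MS).
    have cJ' : (#|J| <= #|J'|)%N by apply: subset_leq_card; exact: subsetUr.
    move=> /(_ _ _ _)/(leq_trans _)-> //.
    + by case: (sc <= Y)%MS; move: #|J| #|J'| #|~: I| cJ'; clear; lia.
    + by do 2!apply: submx_trans (addsmxSl _ _).
    + move=> k; rewrite !inE => /orP[/eqP->|kJ]; first exact: addsmxSr.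
      apply: edgeY kJ _; apply: submx_trans (addsmxSl _ _); exact: addsmxSr.
    move=> /negbTE->; apply/set0Pn; exists e; exact: setU11.
  by exists (n, g).
have rBge o : (2 * #|~: I| + (o == None) <= \rank (B o))%N.
  apply: rank_base => //.
  by case: o => //= _; exact: addsmxSr.
pose A o n := col_mx (col_mx (B o) (f o).2) (normal_rows n).
have lA o i j : line_poly (fun n => A o n i j).
  case: (split_ordP i) => [i' ->|k ->].
    apply: (line_poly_ext (f := fun=> col_mx (B o) (f o).2 i' j)).
      by move=> n; rewrite col_mxEu.
    exact: line_poly_cst.
  apply: (line_poly_ext (f := fun n => normal_rows n k j)).
    by move=> n; rewrite col_mxEd.
  exact: normal_rows_line_poly.
have /fin_all_exists[phi phiP] : forall o, exists phi : 'M[R]_(m, 2) -> R,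
    [/\ line_poly phi, phi (f o).1 != 0 &
      forall n, phi n != 0 -> (\rank (A o (f o).1) <= \rank (A o n))%N].
  by move=> o; have [phi lphi [h1 h2]] := rank_line_open (f o).1 (lA o); exists phi.
have [||n nP] := @line_poly_common _ _ _ phi.
- by move=> o; have [] := phiP o.
- by move=> o; exists (f o).1; have [] := phiP o.
have rA o : (2 * #|~: I| + (o == None) + m + 1 <= \rank (A o n))%N.
  have [_ _ /(_ n (nP o)) h] := phiP o; have [_ h'] := fP o.
  apply: leq_trans h; apply: leq_trans h'; rewrite !leq_add2r; exact: rBge.
exists n; split; first by exists (f None).2; [have [] := fP None | have := rA None].
move=> e; exists (f (Some e)).2; first by have [] := fP (Some e).
by have := rA (Some e); rewrite addn0.
Qed.

(** * From normals to placements *)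

Lemma unit_row_mul i (z : 'cV[R]_N) : (unit_row i *m z) 0 0 = z (enum_rank i) 0.
Proof. by rewrite -rowE mxE. Qed.

Lemma normal_rowsE n k v c : normal_rows n k (enum_rank (Some (v, c))) =
  ((v == src k)%:R - (v == tgt k)%:R) * n k c.
Proof.
rewrite mxE mxE (bigD1 c) //= big1 => [|c' /negbTE nc]; rewrite !mxE !eqxx /=.
  rewrite addr0 !(inj_eq enum_rank_inj) !(inj_eq (@Some_inj _)) !xpair_eqE.
  by rewrite !eqxx !andbT mulrC.
rewrite !(inj_eq enum_rank_inj) !(inj_eq (@Some_inj _)) !xpair_eqE.
by rewrite (eq_sym c c') nc !andbF subrr mulr0.
Qed.

Lemma normal_rows_mul n k (z : 'cV[R]_N) : (normal_rows n *m z) k 0 =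
  \sum_c n k c * (z (enum_rank (Some (src k, c))) 0 - z (enum_rank (Some (tgt k, c))) 0).
Proof.
have -> : (normal_rows n *m z) k 0 = row k (normal_rows n *m z) 0 0.
  by rewrite [RHS]mxE.
rewrite row_mul rowK -mulmxA mxE; apply: eq_bigr => c _; rewrite mxE.
congr (_ * _); have -> : (edge_space k *m z) c 0 = row c (edge_space k *m z) 0 0.
  by rewrite [RHS]mxE.
by rewrite row_mul rowK mulmxBl !mxE -!unit_row_mul !mxE.
Qed.

(** Modulo [pin_space] a coordinate outside [I] is a multiple of the scale, so only inner
    coordinates can keep [y] out of the span. *)
Lemma sub_span_vanish c (y : 'rV[R]_N) :
  (forall v c', v \in I -> (v, c') != (w, c) ->
     y 0 (enum_rank (Some (v, c'))) = 0) ->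
  (y <= pin_space + sc + vr w c)%MS.
Proof.
move=> y0; rewrite [y]row_sum_delta; apply: summx_sub => j _.
have scS : (sc <= pin_space + sc + vr w c)%MS.
  by apply: submx_trans (addsmxSl _ _); exact: addsmxSr.
rewrite -(enum_valK j); case: (enum_val j) => [[v c']|]; last exact: scalemx_sub.
have [e|nwc] := eqVneq (v, c') (w, c).
  by apply: scalemx_sub; rewrite e; exact: addsmxSr.
have [vI|vI] := boolP (v \in I); first by rewrite y0 // scale0r sub0mx.
apply: scalemx_sub; rewrite -/(unit_row _) -(subrK (pos v 0 c' *: sc) (vr v c')).
rewrite addmx_sub ?scalemx_sub //; do 2!apply: submx_trans (addsmxSl _ _).
exact: pin_row_sub.
Qed.

(* With the sign, rev_ord turns n by a right angle. *)
Lemma orthogonal_plane (n d : 'rV[R]_2) : n != 0 -> d != 0 ->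
  \sum_c n 0 c * d 0 c = 0 ->
  exists2 a, a != 0 & forall c, d 0 (rev_ord c) = (-1) ^+ c * a * n 0 c.
Proof.
have zP (u : 'rV[R]_2) : u 0 0 = 0 -> u 0 1 = 0 -> u = 0.
  move=> u0 u1; apply/rowP=> -[[|[|//]] h]; rewrite mxE; [rewrite -u0|rewrite -u1];
    by congr (u _ _); apply/val_inj.
have r0 : rev_ord 0 = 1 :> 'I_2 by apply/val_inj.
have r1 : rev_ord 1 = 0 :> 'I_2 by apply/val_inj.
have all2 (P : 'I_2 -> Prop) : P 0 -> P 1 -> forall c, P c.
  move=> P0 P1 [[|[|//]] h]; [move: P0|move: P1];
    by congr P; apply/val_inj.
have l01 : lift ord0 ord0 = 1 :> 'I_2 by apply/val_inj.
move=> n0 d0; rewrite !big_ord_recl big_ord0 addr0 l01 => nd.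
have [n00|n00] := eqVneq (n 0 0) 0.
  have n01 : n 0 1 != 0 by apply: contraNneq n0 => n01; rewrite (zP n).
  have d1 : d 0 1 = 0.
    by move: nd; rewrite n00 mul0r add0r => /eqP; rewrite mulf_eq0 (negbTE n01) => /eqP.
  exists (- d 0 0 / n 0 1).
    rewrite mulf_neq0 ?invr_eq0 // oppr_eq0; apply: contraNneq d0 => d00.
    by rewrite (zP d).
  by apply: all2; rewrite ?r0 ?r1 /= ?d1 ?n00; field.
exists (d 0 1 / n 0 0).
  rewrite mulf_neq0 ?invr_eq0 //; apply: contraNneq d0 => d01.
  rewrite (zP d) //; move: nd; rewrite d01 mulr0 addr0 => /eqP.
  by rewrite mulf_eq0 (negbTE n00) => /eqP.
apply: all2; rewrite ?r0 ?r1 /=; first by field.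
have e : - (n 0 1 * d 0 1) = n 0 0 * d 0 0.
  by apply/esym/eqP; rewrite -subr_eq0 opprK; apply/eqP.
by rewrite expr1 -[RHS](mulfK n00) -[LHS](mulfK n00) (mulrC (d 0 0)) -e; field.
Qed.

(** A solution of the normal equations is divided by its nonzero scale, which puts the pins in
    place. Its edge vectors are nonzero multiples of the turned normals, so the independence of the
    normal rows carries over. *)
Lemma pinned_realization : exists p c, {in ~: I, p =1 pos} /\
  forall a : 'rV[R]_m,
    (forall v c', v \in I -> (v, c') != (w, c) ->
       \sum_k a 0 k * (((v == src k)%:R - (v == tgt k)%:R) *
         (p (src k) - p (tgt k)) 0 c') = 0) -> a = 0.
Proof.
have [n [[g gw rg] nP]] := generic_normals; pose Y := (pin_space + normal_rows n)%MS.
have rU : (\rank (pin_space + sc)%MS <= 2 * #|~: I| + 1)%N.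
  rewrite (leq_trans (mxrank_adds_leqif _ _)) // leq_add ?rank_pin_space //.
  exact: rank_leq_row.
have rY : (\rank Y <= 2 * #|~: I| + m)%N.
  rewrite (leq_trans (mxrank_adds_leqif _ _)) // leq_add ?rank_pin_space //.
  exact: rank_leq_row.
pose Z := (pin_space + sc + normal_rows n)%MS.
have sZ (h : 'rV_N) (l : nat) (U : 'M_(l, N)) (T : 'M[R]_N) : (U <= T)%MS -> (h <= T)%MS ->
    (normal_rows n <= T)%MS -> (\rank (col_mx (col_mx U h) (normal_rows n)) <= \rank T)%N.
  by move=> UT hT nT; apply: mxrankS; rewrite !col_mx_sub UT hT.
have rZ : (2 * #|~: I| + 1 + m < \rank (Z + g)%MS)%N.
  rewrite -addn1 (leq_trans rg) // sZ ?addsmxSr //.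
    by apply: submx_trans (addsmxSl _ _); exact: addsmxSl.
  by apply: submx_trans (addsmxSl _ _); exact: addsmxSr.
have rZ' : (\rank Z <= 2 * #|~: I| + 1 + m)%N.
  rewrite (leq_trans (mxrank_adds_leqif _ _)) // leq_add //.
  exact: rank_leq_row.
have rZg (h : 'rV_N) : ~~ (h <= Z)%MS -> (\rank Z < \rank (Z + h)%MS)%N.
  by move=> hZ; rewrite ltnNge (geq_leqif (mxrank_leqif_sup (addsmxSl Z h)))
    addsmx_sub submx_refl.
have rZge : (2 * #|~: I| + 1 + m <= \rank Z)%N.
  rewrite -ltnS (leq_trans rZ) // (leq_trans (mxrank_adds_leqif _ _)) //.
  by rewrite -[X in (_ <= X)%N]addn1 leq_add2l rank_leq_row.
(* Some coordinate row of [w] lies outside [Z], because [g], a combination of these rows, enlarges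
   [Z]. *)
have [c cP] : exists c, ~~ (vr w c <= Z)%MS.
  have /row_subPn[c] : ~~ (\matrix_(c < 2) vr w c <= Z)%MS.
    apply: contraTN rZ => wZ; rewrite -leqNgt.
    by have /addsmx_idPl -> := submx_trans gw wZ.
  by rewrite rowK; exists c.
have indep (a : 'rV_m) : (forall v c', v \in I -> (v, c') != (w, c) ->
    (a *m normal_rows n) 0 (enum_rank (Some (v, c'))) = 0) -> a = 0.
  move=> /sub_span_vanish.
  apply: (@independent_mod _ _ _ _ _ _ (2 * #|~: I| + 1 + 1)%N).
    rewrite (leq_trans (mxrank_adds_leqif _ _)) // leq_add //; exact: rank_leq_row.
  rewrite addnAC addn1 (leq_ltn_trans rZge) // (leq_trans (rZg _ cP)) //.
  by rewrite -addsmxA (addsmxC (vr w c)) addsmxA.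
have subY0 l (U : 'M_(l, N)) (z : 'cV_N) : (U <= Y)%MS -> Y *m z = 0 -> U *m z = 0.
  by move=> /submxP[D ->] zY; rewrite -mulmxA zY mulmx0.
(* The functional for [Some e] will keep [e] from collapsing, the one for [None] will keep the scale
   nonzero. *)
have /fin_all_exists[h hP] (o : option 'I_m) : exists h : 'rV_N, ~~ (h <= Y)%MS /\
    if o is Some e then (h <= edge_space e)%MS else (h <= sc)%MS.
  case: o => [e|].
    have [h he rh] := nP e; exists h; split=> //; apply: contraTN rh => hY.
    rewrite -ltnNge [X in (_ < X)%N]addn1 ltnS (leq_trans _ rY) // sZ //; first exact: addsmxSl.
    exact: addsmxSr.
  exists sc; split=> //; apply: contraTN rZge => sY.
  rewrite -ltnNge addnAC addn1 ltnS (leq_trans _ rY) //; apply: mxrankS.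
  by rewrite !addsmx_sub sY addsmxSl addsmxSr.
(* The vectors [cokermx Y *m x] solve the equations in [Y]; a generic [x] makes all functionals
   nonzero at once. *)
have [||x xP] := @line_poly_common R 'cV[R]_N _
    (fun o x => (h o *m cokermx Y *m x) 0 0).
- move=> o; apply: line_poly_linear => a t b.
  by rewrite mulmxDr -scalemxAr !mxE.
- move=> o; have [] := hP o; rewrite submxE => /eqP/rowP/eqfunP.
  rewrite negb_forall => /existsP[j hj] _; exists (delta_mx j 0).
  by rewrite -colE; move: hj; rewrite !mxE.
pose z := cokermx Y *m x.
have zY : Y *m z = 0 by rewrite mulmxA mulmx_coker mul0mx.
have hz o : (h o *m z) 0 0 != 0 by rewrite mulmxA.
pose s := z (enum_rank None) 0.
have s0 : s != 0.
  have [_ /sub_rVP[t ht]] := hP None; have := hz None.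
  by rewrite ht -scalemxAl mxE unit_row_mul mulf_eq0 negb_or => /andP[].
pose p v : 'rV[R]_2 := \row_c (z (enum_rank (Some (v, c))) 0 / s).
have pE v c' : p v 0 c' * s = z (enum_rank (Some (v, c'))) 0.
  by rewrite mxE divfK.
have np k : \sum_c n k c * (p (src k) - p (tgt k)) 0 c = 0.
  apply: (mulIf s0); rewrite mul0r big_distrl /=.
  have /colP/(_ k) := subY0 _ _ _ (addsmxSr pin_space (normal_rows n)) zY.
  rewrite normal_rows_mul [X in _ = X]mxE => e0; rewrite -[RHS]e0.
  apply: eq_bigr => c' _.
  by rewrite -!pE -mulrBl -mulrA !mxE.
have pk k : p (src k) - p (tgt k) != 0.
  apply: contra (hz (Some k)) => /eqP/rowP pst.
  have [_ /submxP[D ->]] := hP (Some k); rewrite -mulmxA mxE big1 // => c' _.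
  have -> : (edge_space k *m z) c' 0 = row c' (edge_space k *m z) 0 0.
    by rewrite [RHS]mxE.
  rewrite row_mul rowK mulmxBl [X in _ * X]mxE [X in _ * (_ + X)]mxE !unit_row_mul.
  have e0 : p (src k) 0 c' - p (tgt k) 0 c' = 0 by have := pst c'; rewrite !mxE.
  by rewrite -!pE -mulrBl e0 !(mul0r, mulr0).
have nk k : row k n != 0.
  apply: contraTneq isT => n0.
  have /rowP/(_ k)/eqP : delta_mx 0 k = 0 :> 'rV[R]_m; last first.
    by rewrite !mxE !eqxx oner_eq0.
  apply: indep => v c' _ _; rewrite -rowE [LHS]mxE normal_rowsE.
  by have /rowP/(_ c') := n0; rewrite !mxE => ->; rewrite mulr0.
have /fin_all_exists[l lP] k : exists a, a != 0 /\ forall c,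
    (p (src k) - p (tgt k)) 0 (rev_ord c) = (-1) ^+ c * a * n k c.
  have [|a a0 aP] := orthogonal_plane (nk k) (pk k).
    by rewrite -[RHS](np k); apply: eq_bigr => c' _; rewrite [X in X * _]mxE.
  by exists a; split=> // c'; rewrite aP [row _ _ _ _]mxE.
(* The right-angle turn exchanges the two coordinates, and with them the erased column. *)
exists p, (rev_ord c); split=> [v vI|a aP].
  apply/rowP=> c'; apply: (mulIf s0); rewrite pE.
  rewrite inE in vI; have := subY0 _ _ _ (submx_trans (pin_row_sub c' vI) (addsmxSl _ _)) zY.
  move=> /rowP/(_ 0); rewrite mulmxBl -scalemxAl mxE [X in _ + X]mxE [X in _ - X]mxE.
  rewrite !unit_row_mul [X in _ = X]mxE => /eqP.
  by rewrite subr_eq0 => /eqP.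
(* Turned back, the rigidity rows are the normal rows rescaled by the nonzero [l k]. *)
have a0 : \row_k (a 0 k * l k) = 0.
  apply: indep => v c' vI nvc; rewrite mxE.
  apply: (mulfI (x := (-1) ^+ c')); first by rewrite signr_eq0.
  rewrite mulr0 big_distrr -[RHS](aP v (rev_ord c') vI) /=; last first.
    by apply: contra nvc; rewrite !xpair_eqE (inj_eq rev_ord_inj).
  by apply: eq_bigr => k _; have [_ ->] := lP k; rewrite mxE normal_rowsE; ring.
apply/rowP=> k; have /rowP/(_ k) := a0; rewrite !mxE => /eqP.
by rewrite mulf_eq0; have [/negbTE-> _] := lP k; rewrite orbF => /eqP.
Qed.

End DirectionNetwork.

(** * Rigidity matrices *)

Section ColumnIndependence.
Variables (F : fieldType) (m n : nat).
Implicit Types (A : 'M[F]_(m, n)) (S : {set 'I_n}).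

Definition independent_on A S :=
  forall a : 'rV_m, (forall j, j \in S -> (a *m A) 0 j = 0) -> a = 0.

Local Notation sel S := (@enum_val _ (mem S)).

Lemma independent_onP A S :
  independent_on A S <-> row_free (colsub (sel S) A).
Proof.
split=> [ind|fr a a0].
  apply: inj_row_free => a a0; apply: ind => j jS.
  have /rowP/(_ (enum_rank_in jS j)) := a0.
  by rewrite mulmx_colsub !mxE enum_rankK_in //; apply: etrans.
apply: (row_free_inj fr); rewrite mul0mx; apply/rowP=> k.
by rewrite mulmx_colsub mxE a0 ?enum_valP // mxE.
Qed.

(** Independent rows make the columns in [S] span the whole column space, so column [j0] is a
    combination of them; [z] records this relation. *)
Lemma independent_on_kernel A S j0 : j0 \notin S -> independent_on A S ->
  exists z : 'cV_n, [/\ A *m z = 0, z j0 0 != 0 &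
    forall j, j \notin S -> j != j0 -> z j 0 = 0].
Proof.
move=> j0S /independent_onP/row_freeP[D AD].
pose y := D *m (A *m delta_mx j0 0) : 'cV_#|S|.
have zE j : j \notin S -> (colsub (sel S) 1%:M *m y) j 0 = 0.
  move=> jS; rewrite mxE big1 // => k _; rewrite !mxE.
  by case: eqP jS => [->|_ _]; rewrite ?enum_valP // mul0r.
exists (delta_mx j0 0 - colsub (sel S) 1%:M *m y); split.
- by rewrite mulmxBr mulmxA mulmx_colsub mulmx1 mulmxA AD mul1mx subrr.
- by rewrite mxE [X in _ + X]mxE zE // mxE !eqxx subr0 oner_neq0.
move=> j jS jj; rewrite mxE [X in _ + X]mxE zE // mxE.
by rewrite (negbTE jj) subr0.
Qed.

(** The columns in [S] have rank [m] and number at most [m], so they form an invertible matrix. *)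
Lemma independent_on_rigid A S (z : 'cV_n) : independent_on A S ->
  (#|S| <= m)%N -> A *m z = 0 -> (forall j, j \notin S -> z j 0 = 0) -> z = 0.
Proof.
move=> /independent_onP fr Sm Az zS.
have full : row_full (colsub (sel S) A).
  by rewrite /row_full eqn_leq rank_leq_col (eqP fr).
have zE : z = colsub (sel S) 1%:M *m rowsub (sel S) z.
  apply/colP=> j; rewrite mxE; have [jS|jS] := boolP (j \in S).
    rewrite (bigD1 (enum_rank_in jS j)) //= !mxE enum_rankK_in // eqxx mul1r.
    rewrite big1 ?addr0 // => k kj; rewrite !mxE.
    case: eqP => [e|]; last by rewrite mul0r.
    by move: kj; rewrite -(enum_valK_in jS k) -e eqxx.
  rewrite zS // big1 // => k _; rewrite !mxE.
  by case: eqP jS => [->|_ _]; rewrite ?enum_valP // mul0r.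
have [D DA] := row_fullP full.
have y0 : rowsub (sel S) z = 0.
  rewrite -[LHS]mul1mx -DA -mulmxA -{1}[A]mulmx1 -mulmx_colsub -mulmxA -zE.
  by rewrite Az mulmx0.
by rewrite zE y0 mulmx0.
Qed.

End ColumnIndependence.

(** * Rigidity matrices at generic placements *)

Section RigidityMatrix.
Variables (R : realType) (V : finType).
Implicit Types (E F : {set {set V}}) (p u : V -> 'rV[R]_2).

Definition edges_within E (X : {set V}) := [set e in E | e \subset X].

Lemma rigidity_mxE E p a x y v c : enum_val a = [set x; y] -> x != y ->
  rigidity_mx E p a (enum_rank (v, c)) =
    ((v == x)%:R - (v == y)%:R) * (p x - p y) 0 c.
Proof.
move=> ea xy; rewrite mxE enum_rankK /= ea !inE.
have sumE (f : V -> R) : \sum_(t in [set x; y]) f t = f x + f y.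
  by rewrite big_setU1 /= ?big_set1 // in_set1.
rewrite sumE !mxE; have [->|vx] /= := eqVneq v x.
  by rewrite (negbTE xy) subrr mulr0n add0r subr0 mul1r.
have [->|vy] := eqVneq v y; first by rewrite mulr1n subrr; ring.
by rewrite mulr0n subrr mul0r.
Qed.

Definition flatten u : 'cV[R]_#|{: V * 'I_2}| :=
  \col_j u (enum_val j).1 0 (enum_val j).2.

Lemma flattenK (z : 'cV[R]_#|{: V * 'I_2}|) :
  exists u, flatten u = z.
Proof.
exists (fun v => \row_c z (enum_rank (v, c)) 0); apply/colP=> j.
by rewrite !mxE -surjective_pairing enum_valK.
Qed.

Lemma flattenE u v c : flatten u (enum_rank (v, c)) 0 = u v 0 c.
Proof. by rewrite mxE enum_rankK. Qed.

Lemma rigidity_mx_mul E p u a x y : enum_val a = [set x; y] -> x != y ->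
  (rigidity_mx E p *m flatten u) a 0 = ((p x - p y) *m (u x - u y)^T) 0 0.
Proof.
move=> ea xy; rewrite mxE (reindex (@enum_rank _)) /=; last first.
  exact/onW_bij/enum_rank_bij.
transitivity (\sum_c \sum_v rigidity_mx E p a (enum_rank (v, c)) *
    flatten u (enum_rank (v, c)) 0).
  by rewrite exchange_big pair_bigA; apply: eq_bigr => -[v c].
rewrite mxE; apply: eq_bigr => c _.
under eq_bigr => v _ do rewrite (rigidity_mxE p v c ea xy) flattenE.
have yx : y != x by rewrite eq_sym.
rewrite (bigD1 x) //= (bigD1 y) //= big1 => [|v /andP[vx vy]].
  by rewrite !eqxx (negbTE xy) (negbTE yx) !mxE !(mulr0n, mulr1n); ring.
by rewrite (negbTE vx) (negbTE vy) mulr0n subrr !mul0r.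
Qed.

Lemma motionP (G : pgraph V) p u : (forall e, e \in edges G -> #|e| = 2%N) ->
  motion G p u <->
  (forall x, x \in pins G -> u x = 0) /\ rigidity_mx (edges G) p *m flatten u = 0.
Proof.
move=> E2; split=> -[u0 uE]; split=> //.
  apply/colP=> a; have := enum_valP a => aE.
  have /eqP/cards2P[x [y [xy ea]]] := E2 _ aE.
  by rewrite (rigidity_mx_mul _ _ ea xy) uE ?mxE // -ea.
move=> x y xyE; have xy : x != y.
  by have := E2 _ xyE; rewrite cards2; case: (x != y).
apply/rowP=> c; rewrite ord1.
have ea : enum_val (enum_rank_in xyE [set x; y]) = [set x; y].
  exact: enum_rankK_in.
by rewrite -(rigidity_mx_mul _ _ ea xy) uE !mxE.
Qed.

Variables (E F : {set {set V}}) (P I : {set V}) (w : V) (p : V -> 'rV[R]_2).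
Hypothesis FE : F \subset E.
Hypothesis F2 : forall e, e \in F -> #|e| = 2%N.
Hypothesis FI : forall e, e \in F -> exists2 v, v \in e & v \in I.
Hypothesis PI : [disjoint P & I].
Hypothesis count_pinned : forall X : {set V},
  (#|edges_within F X| + (w \in X) <= 2 * #|X :&: I|)%N.
Hypothesis count_one_pin : forall X : {set V}, X :&: I != set0 ->
  {in X :\: I &, forall x y, p x = p y} ->
  (#|edges_within F X| + 1 <= 2 * #|X :&: I|)%N.
Hypothesis count_inner : forall X : {set V}, X \subset I -> (2 <= #|X|)%N ->
  (#|edges_within F X| + 3 <= 2 * #|X|)%N.

(** The placement from [pinned_realization] has a nonzero minor of size [#|F|] in the allowed
    columns. It agrees with [p] on [P], so genericity makes the same minor nonzero at [p]. Taking
    [F] inside [E] makes this available for part of a graph. *)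
Lemma generic_independent : generic E P p -> exists c : 'I_2,
  independent_on (rigidity_mx F p)
    [set j | ((enum_val j).1 \in I) && (enum_val j != (w, c))].
Proof.
move=> gen.
have /fin_all_exists[st stP] (k : 'I_#|F|) : exists st : V * V,
    st.1 != st.2 /\ enum_val k = [set st.1; st.2].
  by have /eqP/cards2P[x [y [xy e]]] := F2 (enum_valP k); exists (x, y).
pose src k := (st k).1; pose tgt k := (st k).2.
have st_neq k : src k != tgt k by have [] := stP k.
have stE k : enum_val k = [set src k; tgt k] by have [] := stP k.
have cE (X : {set V}) : #|spanned src tgt X| = #|edges_within F X|.
  rewrite -(card_imset _ (@enum_val_inj _ (mem F))); apply: eq_card => e.
  apply/imsetP/idP => [[k + ->]|].
    by rewrite !inE stE subUset !sub1set -stE enum_valP.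
  rewrite inE => /andP[eF eX]; exists (enum_rank_in eF e); last by rewrite enum_rankK_in.
  by have := stE (enum_rank_in eF e); rewrite enum_rankK_in // inE => ee;
    move: eX; rewrite {1}ee subUset !sub1set.
have edge_inner k : (src k \in I) || (tgt k \in I).
  have [v + vI] := FI (enum_valP k); rewrite stE !inE.
  by case/orP=> /eqP <-; rewrite vI ?orbT.
have [|||q [c [qp ind]]] := @pinned_realization R V I w _ src tgt p st_neq edge_inner.
- by move=> X; rewrite cE.
- by move=> X; rewrite cE; exact: count_one_pin.
- by move=> X; rewrite cE; exact: count_inner.
exists c; set S := [set j | _].
have indq : independent_on (rigidity_mx F q) S.
  move=> a a0; apply: ind => v c' vI vc.
  have := a0 (enum_rank (v, c')); rewrite inE enum_rankK vI vc => /(_ isT) e0.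
  rewrite -[RHS]e0 [RHS]mxE; apply: eq_bigr => k _; congr (_ * _).
  by rewrite (rigidity_mxE _ _ _ (stE k) (st_neq k)).
have /fin_all_exists[fE fEP] (k : 'I_#|F|) : exists i : 'I_#|E|, enum_val i = enum_val k.
  have kE := subsetP FE _ (enum_valP k).
  by exists (enum_rank_in kE (enum_val k)); rewrite enum_rankK_in.
have sE (r : V -> 'rV[R]_2) i j : rigidity_mx F r i j = rigidity_mx E r (fE i) j.
  by rewrite !mxE fEP.
move/independent_onP: indq; rewrite /row_free => /eqP rq.
have [f [g nz]] := nonzero_minor (colsub (@enum_val _ (mem S)) (rigidity_mx F q)).
apply/independent_onP; rewrite /row_free eqn_leq rank_leq_row /=.
rewrite -{1}rq; apply: (@minor_leq_rank _ _ _ _ _ f g).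
have eM (r : V -> 'rV[R]_2) : mxsub f g (colsub (@enum_val _ (mem S)) (rigidity_mx F r)) =
    mxsub (fE \o f) (@enum_val _ (mem S) \o g) (rigidity_mx E r).
  apply/matrixP=> i j; transitivity (rigidity_mx F r (f i) (enum_val (g j))).
    by rewrite [LHS]mxE [LHS]mxE.
  by rewrite sE [RHS]mxE.
rewrite eM; apply: gen; exists q; last by rewrite -eM.
by move=> x xP; apply: qp; rewrite inE (disjointFr PI).
Qed.

End RigidityMatrix.

(** Finitely many minors, each polynomial along lines in the free coordinates, can be made nonzero
    together unless they vanish identically. *)
Lemma generic_exists (R : realType) (V : finType) (E : {set {set V}})
    (P : {set V}) (p0 : V -> 'rV[R]_2) :
  exists2 p : V -> 'rV[R]_2, {in P, p =1 p0} & generic E P p.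
Proof.
pose place (x : {ffun V -> 'rV[R]_2}) v := if v \in P then p0 v else x v.
pose N := #|{: V * 'I_2}|.
(* Minors larger than [#|E|] vanish; bounding [k] gives a finite index type. *)
pose T := {k : 'I_#|E|.+1 & ({ffun 'I_k -> 'I_#|E|} * {ffun 'I_k -> 'I_N})%type}.
pose phi (t : T) (x : {ffun V -> 'rV[R]_2}) :=
  \det (mxsub (tagged t).1 (tagged t).2 (rigidity_mx E (place x))).
have lplace v c : line_poly (fun x => place x v 0 c).
  rewrite /place; case: (v \in P); first exact: line_poly_cst.
  by apply: line_poly_linear => a t b; rewrite !ffunE !mxE.
have lphi t : line_poly (phi t).
  apply: line_poly_det => i j.
  set a := (tagged t).1 i; set b := (tagged t).2 j.
  case eb: (enum_val b) => [v c].
  have entry x : mxsub (tagged t).1 (tagged t).2 (rigidity_mx E (place x)) i j =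
      (v \in (enum_val a : {set V}))%:R *
      \sum_(y in (enum_val a : {set V})) (place x v 0 c + -1 * place x y 0 c).
    rewrite mxE mxE -/a -/b eb /=; case: ifP => _; last by rewrite mul0r.
    by rewrite mul1r; apply: eq_bigr => y _; rewrite mulN1r.
  apply: line_poly_ext (fun x => esym (entry x)) _.
  apply: line_poly_mul; first exact: line_poly_cst.
  apply: line_poly_sum => y; apply: line_poly_add => //.
  by apply: line_poly_mul => //; exact: line_poly_cst.
(* Identically vanishing minors are replaced by 1, so every member of the family is nonzero
   somewhere. *)
pose psi t x := if pselect (exists y, phi t y != 0) then phi t x else 1.
have [||x xP] := @line_poly_common _ _ _ psi.
- by move=> t; rewrite /psi; case: pselect => h //=; exact: line_poly_cst.
- move=> t; rewrite /psi; case: pselect => [[y yP]|h] /=; first by exists y.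
  by exists 0; rewrite oner_neq0.
exists (place x) => [v vP|k f g [q qP nz]]; first by rewrite /place vP.
have kE : (k < #|E|.+1)%N.
  by rewrite ltnS (leq_trans (minor_leq_rank nz)) // rank_leq_row.
pose t : T := Tagged (fun k : 'I_#|E|.+1 =>
  ({ffun 'I_k -> 'I_#|E|} * {ffun 'I_k -> 'I_N})%type)
  ((finfun f : {ffun 'I_(Ordinal kE) -> _}), finfun g).
have phiE y : phi t y = \det (mxsub f g (rigidity_mx E (place y))).
  by apply: (congr1 (@determinant R k)); apply/matrixP=> i j; rewrite mxE [RHS]mxE !ffunE.
have rigE (r s : V -> 'rV[R]_2) : r =1 s -> rigidity_mx E r = rigidity_mx E s.
  move=> rs; apply/matrixP=> i j; rewrite !mxE; case: (enum_val j) => v c.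
  by congr (if _ then _ else _); apply: eq_bigr => y _; rewrite !rs.
have := xP t; rewrite /psi; case: pselect => [h|[]] /=; first by rewrite phiE.
exists [ffun v => q v]; rewrite phiE (rigE _ q) // => v; rewrite /place ffunE.
by case: ifP => // vP; rewrite qP // /place vP.
Qed.

(** * Upper bounds for the rank *)

Section RankBound.
Variables (R : realType) (V : finType) (p : V -> 'rV[R]_2).
Implicit Types (E : {set {set V}}) (X : {set V}).

Lemma rank_rigidity_cover E E1 E2 : E \subset E1 :|: E2 ->
  (\rank (rigidity_mx E p) <= \rank (rigidity_mx E1 p) + \rank (rigidity_mx E2 p))%N.
Proof.
move=> sE; apply: leq_trans (mxrank_adds_leqif _ _).
apply: mxrankS; apply/row_subP=> a.
have rowE E' (b : 'I_#|E'|) : enum_val b = enum_val a ->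
    row a (rigidity_mx E p) = row b (rigidity_mx E' p).
  by move=> e; apply/rowP=> j; rewrite !mxE e.
have := subsetP sE _ (enum_valP a); rewrite inE => /orP[aE|aE].
  rewrite (rowE _ (enum_rank_in aE (enum_val a))) ?enum_rankK_in //.
  by apply: submx_trans (row_sub _ _) (addsmxSl _ _).
rewrite (rowE _ (enum_rank_in aE (enum_val a))) ?enum_rankK_in //.
by apply: submx_trans (row_sub _ _) (addsmxSr _ _).
Qed.

(** If [X] sits at one place the matrix is 0. Otherwise every row annihilates the translations and a
    rotation, so a vector of the row space is determined by [2 * #|X| - 3] coordinates. *)
Lemma rank_rigidity_within E X :
  (forall e, e \in E -> #|e| = 2%N /\ e \subset X) -> (2 <= #|X|)%N ->
  (\rank (rigidity_mx E p) + 3 <= 2 * #|X|)%N.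
Proof.
move=> EX X2; have edgeP (a : 'I_#|E|) : exists x y,
    [/\ x != y, x \in X, y \in X & enum_val a = [set x; y]].
  have [/eqP/cards2P[x [y [xy e]]]] := EX _ (enum_valP a).
  by rewrite e subUset !sub1set => /andP[xX yX]; exists x, y.
have mul0 u : (forall x y, ((p x - p y) *m (u x - u y)^T) 0 0 = 0) ->
    rigidity_mx E p *m flatten u = 0.
  move=> u0; apply/colP=> a; have [x [y [xy _ _ ea]]] := edgeP a.
  by rewrite (rigidity_mx_mul _ _ ea xy) u0 mxE.
have [|] := boolP [forall x in X, forall y in X, p x == p y].
  move=> /forall_inP pX.
  have -> : rigidity_mx E p = 0; last by rewrite mxrank0; lia.
  apply/matrixP=> a j; have [x [y [xy xX yX ea]]] := edgeP a.
  rewrite -(enum_valK j); case: (enum_val j) => v c.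
  rewrite (rigidity_mxE _ _ _ ea xy) [RHS]mxE.
  by have /forall_inP/(_ y yX)/eqP -> := pX x xX; rewrite subrr mxE mulr0.
rewrite negb_forall_in => /exists_inP[a aX]; rewrite negb_forall_in.
case/exists_inP=> b bX pab.
have [c0 pc0] : exists c, p a 0 c != p b 0 c.
  by apply/existsP; move: pab; rewrite -negb_forall; apply: contra => /eqfunP/rowP/eqP.
have ba : b != a by apply: contraNneq pab => ->.
(* Within [X] this leaves out both coordinates of [a], recovered by translations, and one of [b],
   recovered by a rotation. *)
pose S := [set enum_rank i | i in (b, c0) |: setX (X :\ a :\ b) [set: 'I_2]].
have cS : (#|S| + 3 = 2 * #|X|)%N.
  rewrite card_imset; last exact: enum_rank_inj.
  rewrite cardsU1 cardsX cardsT card_ord !inE eqxx /=.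
  by rewrite (cardsD1 a X) aX (cardsD1 b (X :\ a)) !inE ba bX /=; clear; lia.
rewrite -cS leq_add2r.
suff : independent_on (row_base (rigidity_mx E p)) S.
  move=> /independent_onP/eqP {1}<-; exact: rank_leq_col.
move=> al al0; have /submxP[D yE] : (al *m row_base (rigidity_mx E p) <= rigidity_mx E p)%MS.
  by apply: submx_trans (submxMl _ _) _; rewrite eq_row_base.
set y := al *m _ in al0 yE; suff y0 : y = 0.
  by apply: (row_free_inj (row_base_free (rigidity_mx E p))); rewrite mul0mx.
pose yv v c := y 0 (enum_rank (v, c)).
have yX v c : v \notin X -> yv v c = 0.
  move=> vX; rewrite /yv yE mxE big1 // => k _.
  have [s [t [st sX tX ea]]] := edgeP k; rewrite (rigidity_mxE _ _ _ ea st).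
  have -> : (v == s) = false by apply: contraNF vX => /eqP->.
  have -> : (v == t) = false by apply: contraNF vX => /eqP->.
  by rewrite mulr0n subrr mul0r mulr0.
have yab v c : v != a -> v != b -> yv v c = 0.
  move=> va vb; have [vX|vX] := boolP (v \in X); last exact: yX.
  by apply: al0; apply: imset_f; rewrite !inE /= va vb vX orbT.
have ybc : yv b c0 = 0 by apply: al0; apply: imset_f; rewrite setU11.
have yu u : rigidity_mx E p *m flatten u = 0 -> \sum_v \sum_c yv v c * u v 0 c = 0.
  move=> u0; have : (y *m flatten u) 0 0 = 0 by rewrite yE -mulmxA u0 mulmx0 mxE.
  rewrite mxE (reindex (@enum_rank _)) /=; last exact/onW_bij/enum_rank_bij.
  move=> e0; rewrite -[RHS]e0 pair_bigA; apply: eq_bigr => -[v c] _ /=.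
  by rewrite flattenE.
(* The infinitesimal rotation about [a]; its coordinate [rev_ord c0] at [b] is nonzero because [p a]
   and [p b] differ in [c0]. *)
pose rot v : 'rV[R]_2 := \row_c ((-1) ^+ c * (p v 0 (rev_ord c) - p a 0 (rev_ord c))).
have ybr : yv b (rev_ord c0) = 0.
  have /yu : rigidity_mx E p *m flatten rot = 0.
    apply: mul0 => s t; rewrite mxE !big_ord_recl big_ord0 !mxE /=.
    have -> : rev_ord ord0 = lift ord0 ord0 :> 'I_2 by apply/val_inj.
    have -> : rev_ord (lift ord0 ord0) = ord0 :> 'I_2 by apply/val_inj.
    by rewrite expr0 expr1; ring.
  rewrite (bigD1 b) //= [X in _ + X]big1 ?addr0 => [|v vb]; last first.
    apply: big1 => c _; have [->|va] := eqVneq v a; last by rewrite yab ?mul0r.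
    by rewrite mxE subrr !mulr0.
  rewrite (bigD1 (rev_ord c0)) //= big1 ?addr0 => [|c nc]; last first.
    have -> : c = c0.
      by move: c c0 nc {pc0 S cS al0 ybc} => [[|[|//]] h] [[|[|//]] h'] // _; apply/val_inj.
    by rewrite ybc mul0r.
  move/eqP; rewrite mulf_eq0 mxE rev_ordK mulf_eq0 signr_eq0 /= subr_eq0.
  by rewrite (eq_sym (p b 0 c0)) (negbTE pc0) orbF => /eqP.
have yb c : yv b c = 0.
  have [->|nc] := eqVneq c c0 => //; rewrite -ybr; congr (yv b _).
  by move: c c0 nc {pc0 S cS al0 ybc ybr} => [[|[|//]] h] [[|[|//]] h'] // _; apply/val_inj.
have ya c : yv a c = 0.
  have /yu : rigidity_mx E p *m flatten (fun=> delta_mx 0 c) = 0.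
    by apply: mul0 => s t; rewrite subrr trmx0 mulmx0 mxE.
  rewrite (bigD1 a) //= [X in _ + X]big1 ?addr0 => [|v va]; last first.
    apply: big1 => c' _; have [->|vb] := eqVneq v b; last by rewrite yab ?mul0r.
    by rewrite yb mul0r.
  rewrite (bigD1 c) //= big1 ?addr0 => [|c' nc]; last by rewrite mxE (negbTE nc) mulr0.
  by rewrite mxE !eqxx mulr1.
apply/rowP=> j; rewrite [RHS]mxE -(enum_valK j); case: (enum_val j) => v c.
rewrite -/(yv v c); have [->|va] := eqVneq v a => //.
by have [->|vb] := eqVneq v b => //; exact: yab.
Qed.

End RankBound.

(** * Counts and motions of pinned graphs *)

Section Counts.
Variables (R : realType) (V : finType) (G : pgraph V).
Hypothesis gG : pinned_graph G.
Local Notation I := (inner G).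
Local Notation P := (pins G).
Local Notation E := (edges G).

(** The full rank of the graph with its body is at most the rank of the counted edges and the
    complete graph plus one for each remaining edge. Bounding the former two jointly gives the
    pinned count, separately the count on [X]. *)
Lemma isostatic_counts : pinned_isostatic R G ->
  (forall I' : {set V}, I' \subset I ->
     #|edges_within E (I' :|: P)| <= 2 * #|I'|)%N /\
  (forall X : {set V}, 2 <= #|X| -> #|edges_within E X| + 3 <= 2 * #|X|)%N.
Proof.
case: gG => dIP EP [cE [m B2 rig]]; pose W := (V + 'I_m)%type.
have [p _ gp] := @generic_exists R W (with_body_edges G m) set0 (fun=> 0).
have := rig p gp; set Eb := with_body_edges G m.
pose il (A : {set V}) : {set W} := [set inl x | x in A].
pose ile (D : {set {set V}}) : {set {set W}} := [set il e | e : {set V} in D].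
set B := body_verts G m in B2 *; pose K := complete_edges B.
have il_inj : injective il by apply: imset_inj => x y [].
have cil A : #|il A| = #|A| by apply: card_imset => x y [].
have cile D : #|ile D| = #|D| by apply: card_imset.
have ilS (X Y : {set V}) : X \subset Y -> il X \subset il Y by exact: imsetS.
have KP e : e \in K -> #|e| = 2%N /\ e \subset B.
  by rewrite inE => /andP[eB /eqP].
have cW : #|with_body_verts G m| = (#|I| + #|B|)%N.
  rewrite cardsU [X in (_ - X)%N](_ : _ = 0%N) ?subn0 -?cil //.
  apply/eqP; rewrite cards_eq0 -subset0; apply/subsetP=> -[v|j].
    rewrite inE => /andP[/imsetP[x xI [->]]]; rewrite inE.
    case/orP=> /imsetP[y yP] // [e]; rewrite e inE.
    by have := disjointFr dIP xI; rewrite e yP.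
  by rewrite inE => /andP[/imsetP[x xI]].
have EbS (D : {set {set V}}) : Eb \subset (ile D :|: K) :|: ile (E :\: D).
  apply/subsetP=> e; rewrite inE => /orP[/imsetP[f fE ->]|eK]; last first.
    by rewrite in_setU in_setU [e \in K]eK orbT.
  rewrite in_setU in_setU; have [fD|fD] := boolP (f \in D).
    by rewrite [_ \in ile D]imset_f.
  by rewrite [_ \in ile (_ :\: _)]imset_f ?orbT // inE fD.
have rest (D : {set {set V}}) : D \subset E ->
    (\rank (rigidity_mx (ile (E :\: D)) p) + #|D| <= #|E|)%N.
  move=> DE; rewrite -(cardsID D E) (setIidPr DE) addnC leq_add2l -cile.
  exact: rank_leq_row.
have inE2 (X : {set V}) (e : {set W}) : e \in ile (edges_within E X) ->
    #|e| = 2%N /\ e \subset il X.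
  case/imsetP=> f; rewrite inE => /andP[fE fX] ->; split; last exact: ilS.
  by rewrite cil; have [] := EP _ fE.
have withinS (X : {set V}) : edges_within E X \subset E.
  by apply/subsetP=> e; rewrite inE => /andP[].
move=> rk; split=> [I' I'S|X X2].
  set D := edges_within E (I' :|: P).
  have r1 := rank_rigidity_cover p (EbS D); have r2 := rest D (withinS _).
  have sB : il (I' :|: P) :|: B = il I' :|: B.
    rewrite /il imsetU -setUA; congr (_ :|: _); apply/setUidPr.
    exact: subsetUl.
  have X2 : (2 <= #|il I' :|: B|)%N.
    by apply: leq_trans B2 _; apply: subset_leq_card; exact: subsetUr.
  have r3 : (\rank (rigidity_mx (ile D :|: K) p) + 3 <= 2 * #|il I' :|: B|)%N.
    apply: rank_rigidity_within => // e; rewrite inE => /orP[eD|/KP[e2 eB]].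
      have [e2 eX] := inE2 _ _ eD; split=> //; rewrite -sB.
      by apply: subset_trans eX _; exact: subsetUl.
    by split=> //; apply: subset_trans eB _; exact: subsetUr.
  have c3 : (#|il I' :|: B| <= #|I'| + #|B|)%N by rewrite -cil leq_card_setU.
  move: rk r1 r2 r3 c3; rewrite cW cE.
  move: (\rank _) (\rank _) (\rank _) #|D| #|I| #|I'| #|B| #|_ :|: _|.
  by clear; lia.
set D := edges_within E X.
have r1 := rank_rigidity_cover p (EbS D); have r2 := rest D (withinS _).
have r3 := rank_rigidity_cover p (subxx (ile D :|: K)).
have r4 : (\rank (rigidity_mx (ile D) p) + 3 <= 2 * #|X|)%N.
  rewrite -(cil X); apply: rank_rigidity_within; rewrite ?cil //; exact: inE2.
have r5 : (\rank (rigidity_mx K p) + 3 <= 2 * #|B|)%N.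
  exact: rank_rigidity_within KP B2.
move: rk r1 r2 r3 r4 r5; rewrite cW cE.
move: (\rank _) (\rank _) (\rank _) (\rank _) (\rank _) #|D| #|I| #|B| #|X|.
by clear; lia.
Qed.

End Counts.

(** * Moving all inner vertices, and rigid parts *)

Section Motions.
Variables (R : realType) (V : finType) (G : pgraph V) (p0 : V -> 'rV[R]_2).
Hypothesis gG : pinned_graph G.
Local Notation I := (inner G).
Local Notation P := (pins G).
Local Notation E := (edges G).
Hypothesis count_inner : forall X : {set V}, (2 <= #|X|)%N ->
  (#|edges_within E X| + 3 <= 2 * #|X|)%N.

Lemma edges_withinS (F : {set {set V}}) (X Y : {set V}) :
  {in F, forall e : {set V}, e \subset X -> e \subset Y} ->
  (#|edges_within F X| <= #|edges_within F Y|)%N.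
Proof.
move=> h; apply: subset_leq_card; apply/subsetP=> e.
by rewrite !inE => /andP[eF eX]; rewrite eF (h e).
Qed.

(** The strict count allows a column of any inner [w] to be erased with the rows still independent;
    the resulting column relation is a motion of [w]. A generic combination moves every inner
    vertex. *)
Lemma sparse_all_inner_move :
  (forall I' : {set V}, I' \subset I -> I' != set0 ->
     (#|edges_within E (I' :|: P)| + 1 <= 2 * #|I'|)%N) ->
  all_inner_move G p0.
Proof.
case: gG => dIP EP sparse p _ gen.
have E2 e : e \in E -> #|e| = 2%N by case/EP.
have EI e : e \in E -> exists2 v, v \in e & v \in I by case/EP.
have within X : X :&: I != set0 -> (#|edges_within E X| + 1 <= 2 * #|X :&: I|)%N.
  move=> XI; apply: leq_trans (sparse _ (subsetIr _ _) XI); rewrite leq_add2r.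
  apply: edges_withinS => e eE eX; have [_ eIP _] := EP e eE.
  apply/subsetP=> v ve; have := subsetP eIP v ve; rewrite !inE.
  by rewrite (subsetP eX v ve).
have /fin_all_exists[u uP] (w : V) : exists u : V -> 'rV[R]_2,
    w \in I -> motion G p u /\ u w != 0.
  have [wI|wI] := boolP (w \in I); last by exists (fun=> 0).
  have [||||c ind] := @generic_independent R V E E P I w p (subxx E) E2 EI _ _ _ _ gen.
  - by rewrite disjoint_sym.
  - move=> X; have [X0|/within] := eqVneq (X :&: I) set0; last by case: (w \in X) => /=; lia.
    have wX : w \notin X by have := in_set0 w; rewrite -X0 inE wI andbT => ->.
    suff -> : edges_within E X = set0 by rewrite cards0 (negbTE wX).
    apply/setP=> e; rewrite in_set0 inE; apply/negP=> /andP[eE eX].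
    have [v ve vI] := EI e eE; have := in_set0 v.
    by rewrite -X0 inE (subsetP eX v ve) vI.
  - by move=> X XI _; exact: within.
  - by move=> X _; exact: count_inner.
  have jS : enum_rank (w, c) \notin
      [set j | ((enum_val j).1 \in I) && (enum_val j != (w, c))].
    by rewrite inE enum_rankK eqxx andbF.
  have [z [Ez zw zS]] := independent_on_kernel jS ind.
  have [v vz] := flattenK z; exists v => _; split.
    apply/motionP => //; split; last by rewrite vz.
    move=> x xP; apply/rowP=> d; rewrite -flattenE vz zS ?mxE //.
      by rewrite inE enum_rankK /= (disjointFl dIP xP).
    apply: contraTneq wI => /enum_rank_inj[<- _].
    by rewrite (disjointFl dIP xP).
  by apply: contraNneq zw => v0; rewrite -vz flattenE v0 mxE.
have /fin_all_exists[d dP] (v : V) : exists d : 'I_2, v \in I -> u v v 0 d != 0.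
  have [vI|vI] := boolP (v \in I); last by exists 0.
  have [_] := uP v vI => uv; suff /existsP[d dP] : [exists d, u v v 0 d != 0] by exists d.
  rewrite -negb_forall; apply: contra uv => /eqfunP u0.
  by apply/eqP/rowP=> d; rewrite u0 mxE.
pose U (x : {ffun V -> R^o}) v := \sum_(w in I) (x w : R) *: u w v.
(* The chosen coordinate at [v] is linear in the coefficients and nonzero for [u v] alone. *)
have [||x xP] := @line_poly_common R {ffun V -> R^o} V
    (fun v x => if v \in I then U x v 0 (d v) else 1).
- move=> v; case: (v \in I); last exact: line_poly_cst.
  apply: (line_poly_ext (f := fun x : {ffun V -> R^o} => \sum_(w in I) (x w : R) * u w v 0 (d v))).
    by move=> x; rewrite /U summxE; apply: eq_bigr => w _; rewrite mxE.
  apply: line_poly_sum => w; apply: line_poly_mul; last exact: line_poly_cst.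
  by apply: line_poly_linear => a t b; rewrite !ffunE.
- move=> v; case vI: (v \in I); last by exists 0; rewrite oner_neq0.
  exists [ffun w => (w == v)%:R]; rewrite /U (bigD1 v) //= big1 => [|w /andP[_ wv]].
    by rewrite ffunE eqxx scale1r addr0 dP.
  by rewrite ffunE (negbTE wv) scale0r.
exists (U x) => [|v vI]; last first.
  by have := xP v; rewrite vI; apply: contraNneq => ->; rewrite mxE.
split=> [y yP|y z yzE].
  by apply: big1 => w wI; have [[u0 _] _] := uP w wI; rewrite u0 // scaler0.
have trZ (a : R) (M : 'rV[R]_2) : (a *: M)^T = a *: M^T.
  by apply/matrixP=> i j; rewrite !mxE.
rewrite /U -sumrB raddf_sum mulmx_sumr; apply: big1 => w wI.
have [[_ uE] _] := uP w wI.
by rewrite -scalerBr /= trZ -scalemxAr uE // scaler0.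
Qed.

(* The vertex w outside I' plays the role of an isolated inner vertex, so that
   generic_independent applies to the edges within I' :|: P. *)
Lemma tight_rigid (H : pgraph V) (I' : {set V}) (w : V) (p u : V -> 'rV[R]_2) :
  (forall J : {set V}, J \subset I ->
     #|edges_within E (J :|: P)| <= 2 * #|J|)%N ->
  {in P &, injective p} -> I' \subset I -> w \in I -> w \notin I' ->
  (2 * #|I'| <= #|edges_within E (I' :|: P)|)%N ->
  pins H = P -> edges_within E (I' :|: P) \subset edges H ->
  generic (edges H) (pins H) p -> motion H p u -> {in I', u =1 fun=> 0}.
Proof.
case: gG => dIP EP sparse pinj I'S wI wI' tight HP.
set F := edges_within E _ => FH gen [u0 uE].
pose I1 := w |: I'.
have I1S : I1 \subset I by rewrite subUset sub1set wI.
have dI1P : [disjoint I1 & P] by exact: disjointWl I1S dIP.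
have wP : w \notin P by rewrite (disjointFr dIP wI).
have FE e : e \in F -> e \in E by rewrite inE => /andP[].
have F2 e : e \in F -> #|e| = 2%N by move/FE/EP => [].
have Fsub e v : e \in F -> v \in e -> v \in I' :|: P.
  by rewrite inE => /andP[_ /subsetP]; exact.
have FI' e : e \in F -> exists2 v, v \in e & v \in I'.
  move=> eF; have [_ _ [v ve vI]] := EP e (FE e eF); exists v => //.
  by have := Fsub e v eF ve; rewrite inE (disjointFr dIP vI) orbF.
have cX (X : {set V}) : (#|X :&: I1| = (w \in X) + #|X :&: I'|)%N.
  rewrite (cardsD1 w) !inE eqxx andbT; congr (_ + _)%N; apply: eq_card => v.
  by rewrite !inE; case: eqVneq => //= ->; rewrite (negbTE wI') andbF.
have sX (X Y : {set V}) : {in X :&: (I' :|: P), forall v, v \in Y} ->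
    (#|edges_within F X| <= #|edges_within E Y|)%N.
  move=> XY; apply: subset_leq_card; apply/subsetP=> e.
  rewrite inE => /andP[eF /subsetP eX]; rewrite inE (FE e eF).
  by apply/subsetP=> v ve; apply: XY; rewrite inE eX //=; exact: Fsub eF ve.
have within X : (#|edges_within F X| <= 2 * #|X :&: I'|)%N.
  apply: leq_trans (sparse _ (subset_trans (subsetIr _ _) I'S)).
  apply: sX => v; rewrite !inE => /andP[-> /orP[->|->]] //.
  by rewrite orbT.
have F0 X : (#|X :&: (I' :|: P)| <= 1)%N -> edges_within F X = set0.
  move=> X1; apply/setP=> e; rewrite in_set0; apply/negbTE/negP.
  rewrite inE => /andP[eF eX]; have := F2 e eF.
  suff : (#|e| <= 1)%N by lia.
  apply: leq_trans X1; apply: subset_leq_card; rewrite subsetI eX.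
  by apply/subsetP=> v; exact: Fsub eF.
have [||||||c ind] := @generic_independent R V (edges H) F P I1 w p FH F2.
- by move=> e /FI'[v ve vI]; exists v; rewrite // inE vI orbT.
- by rewrite disjoint_sym.
- move=> X; rewrite cX; have := within X; case: (w \in X);
  by move: #|_| #|_|; clear; lia.
(* If [w] is in [X], its contribution of 2 suffices. Otherwise [X] contains at most one pin, the
   pins being at distinct places, and [count_inner] applies once two vertices are present. *)
- move=> X XI px; rewrite cX; have [wX|wX] := boolP (w \in X).
    by have := within X; move: #|_| #|_|; clear; lia.
  move: XI; rewrite -card_gt0 cX (negbTE wX) add0n => XI.
  have P1 : (#|X :&: P| <= 1)%N.
    apply/card_le1_eqP => x y; rewrite !inE => /andP[xX xP] /andP[yX yP].
    by apply: pinj => //; apply: px; rewrite inE ?xX ?yX ?(disjointFl dI1P xP)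
      ?(disjointFl dI1P yP).
  pose Y := X :&: (I' :|: P).
  have cY : (#|Y| <= #|X :&: I'| + 1)%N.
    rewrite /Y setIUr (leq_trans (leq_card_setU _ _)) // leq_add2l //.
  have [Y2|Y1] := leqP 2 #|Y|; last by rewrite F0 // cards0; lia.
  have := count_inner Y2; have : (#|edges_within F X| <= #|edges_within E Y|)%N.
    by apply: sX.
  by lia.
- move=> X XI1 X2; pose Y := X :&: (I' :|: P).
  have [Y2|Y1] := leqP 2 #|Y|; last by rewrite F0 // cards0; lia.
  have := count_inner Y2; have : (#|edges_within F X| <= #|edges_within E Y|)%N.
    by apply: sX.
  have : (#|Y| <= #|X|)%N by apply: subset_leq_card; exact: subsetIl.
  by lia.
- by rewrite -HP.
(* No edge of [F] meets [w], so its columns vanish and independence persists on the coordinates of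
   [I'], of which there are at most [#|F|]. *)
pose S := [set j : 'I_#|{: V * 'I_2}| | (enum_val j).1 \in I'].
have indS : independent_on (rigidity_mx F p) S.
  move=> a a0; apply: ind => j; rewrite !inE => /andP[/orP[/eqP jw|jI] _]; last first.
    by apply: a0; rewrite inE.
  rewrite mxE big1 // => k _; rewrite -(enum_valK j).
  case: (enum_val j) jw => v d /= ->.
  have kF := enum_valP k; have /eqP/cards2P[x [y [xy ek]]] := F2 _ kF.
  have nw v' : v' \in [set x; y] -> (w == v') = false.
    rewrite -ek => v'k; apply/eqP => wv; have := Fsub _ _ kF v'k.
    by rewrite -wv inE (negbTE wI') (negbTE wP).
  by rewrite (rigidity_mxE _ _ _ ek xy) !nw ?inE ?eqxx ?orbT // subrr mul0r mulr0.
(* Cutting [u] off outside [I'] preserves the equations of [F], whose endpoints lie in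
   [I' :|: P]. *)
pose u' v := if v \in I' then u v else 0.
have u'E v : v \in I' :|: P -> u' v = u v.
  rewrite inE /u'; case: (v \in I') => //= vP.
  by rewrite u0 // HP.
have z0 : flatten u' = 0.
  apply: independent_on_rigid indS _ _ _.
  - rewrite (_ : S = [set enum_rank i | i in setX I' [set: 'I_2]]).
      rewrite card_imset; last exact: enum_rank_inj.
      by rewrite cardsX cardsT card_ord mulnC.
    apply/setP=> j; rewrite inE; apply/idP/imsetP => [jI|[i + ->]].
      by exists (enum_val j); rewrite ?enum_valK // !inE jI.
    by rewrite !inE enum_rankK andbT.
  - have [|_ ->//] := (motionP (G := PGraph I' P F) p u' F2).1.
    split=> [x xP|x y xyF] /=.
      by rewrite u'E ?inE ?xP ?orbT // u0 ?HP.
    rewrite !u'E; first by apply: uE; exact: (subsetP FH).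
      by apply: Fsub xyF _; rewrite set22.
    by apply: Fsub xyF _; rewrite set21.
  move=> j; rewrite inE mxE /u' => /negbTE->; by rewrite mxE.
move=> v vI'; apply/rowP=> d; have := flattenE u' v d.
by rewrite z0 mxE /u' vI' => <-; rewrite mxE.
Qed.

End Motions.

(** * The equivalence *)

Section Assur.
Variables (R : realType) (V : finType) (G : pgraph V) (p0 : V -> 'rV[R]_2).
Local Notation I := (inner G).
Local Notation P := (pins G).
Local Notation E := (edges G).
Local Notation inc := (incident_verts (contracted_ends G)).
Hypothesis gG : pinned_graph G.
Hypothesis I0 : I != set0.
Hypothesis noiso : no_isolated_pin G.
Hypothesis pinj : {in P &, injective p0}.
Hypothesis iso : pinned_isostatic R G.

Let disj : [disjoint I & P]. Proof. by case: gG. Qed.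
Let cardE : #|E| = (2 * #|I|)%N. Proof. by case: iso. Qed.

Let count_pinned (I' : {set V}) : I' \subset I ->
  (#|edges_within E (I' :|: P)| <= 2 * #|I'|)%N.
Proof. by have [h _] := isostatic_counts gG iso; exact: h. Qed.

Let count_inner (X : {set V}) : (2 <= #|X|)%N ->
  (#|edges_within E X| + 3 <= 2 * #|X|)%N.
Proof. by have [_ h] := isostatic_counts gG iso; exact: h. Qed.

Let edge_card e : e \in E -> #|e| = 2%N.
Proof. by move=> eE; have [] := gG.2 e eE. Qed.

Let edge_sub e v : e \in E -> v \in e -> v \in I :|: P.
Proof. by move=> eE; have [_ /subsetP h _] := gG.2 e eE; exact: h. Qed.

Let edge_inner e : e \in E -> exists2 v, v \in e & v \in I.
Proof. by move=> eE; have [] := gG.2 e eE. Qed.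

(** Otherwise all [2 * #|I|] edges would be counted by [I :\ v], which allows two fewer. *)
Lemma inner_covered v : v \in I -> exists2 e, e \in E & v \in e.
Proof.
move=> vI; have /count_pinned c : I :\ v \subset I by exact: subD1set.
have /subsetPn[e eE eW] : ~~ (E \subset edges_within E ((I :\ v) :|: P)).
  apply: contraTN c => /subset_leq_card; rewrite cardE (cardsD1 v) vI -ltnNge.
  by apply: leq_trans; clear; lia.
exists e => //; apply: contraR eW => ve; rewrite inE eE /=.
apply/subsetP=> x xe; have := edge_sub eE xe; rewrite !inE.
by case: eqVneq => // xv; rewrite -xv xe in ve.
Qed.

(** * Minimality and rigidity circuits *)

Lemma incident_inner (F : {set {set V}}) v : F \subset E ->
  (Some v \in inc F) = (v \in I) && [exists e in F, v \in e].
Proof.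
move=> FE; apply/bigcupP/andP=> [[e eF /imsetP[x xe]]|[vI /exists_inP[e eF ve]]].
  rewrite /contract; case: ifP => // xP [->].
  have := edge_sub (subsetP FE _ eF) xe; rewrite inE xP orbF => ->; split=> //.
  by apply/exists_inP; exists e.
exists e => //; apply/imsetP; exists v => //.
by rewrite /contract (disjointFr disj vI).
Qed.

Lemma incident_pin (F : {set {set V}}) e x :
  e \in F -> x \in e -> x \in P -> None \in inc F.
Proof.
move=> eF xe xP; apply/bigcupP; exists e => //.
by apply/imsetP; exists x; rewrite // /contract xP.
Qed.

Lemma card_incident (F : {set {set V}}) :
  #|inc F| = ((None \in inc F) + #|[set v | Some v \in inc F]|)%N.
Proof.
rewrite (cardsD1 None) -(card_imset (mem [set v | Some v \in inc F]) (@Some_inj _)).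
congr (_ + _)%N; apply: eq_card => -[v|]; rewrite !inE /=.
  apply/idP/imsetP=> [h|[v' + [->]]]; last by rewrite inE.
  by exists v; rewrite ?inE.
by apply/esym/negbTE/imsetP=> -[].
Qed.

(** If [F] touches p* and the inner vertices [J], the bound wanted is [#|F| <= 2 * #|J| - 1]: this
    is minimality when [J] differs from [I], and [#|F| < #|E|] otherwise. If [F] avoids p*,
    [count_inner] gives the bound. *)
Lemma minimal_circuit : minimal_pinned G ->
  rigidity_circuit (contracted_ends G) E.
Proof.
move=> minG.
have E0 : E != set0 by rewrite -card_gt0 cardE muln_gt0 card_gt0.
split=> //.
  have IE : [set v | Some v \in inc E] = I.
    apply/setP=> v; rewrite inE incident_inner // andb_idr // => vI.
    by apply/exists_inP; exact: inner_covered.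
  rewrite card_incident IE cardE; suff -> : None \in inc E by rewrite mulnDr addnC.
  (* If no edge met a pin, [count_inner] for [I] would contradict [#|E| = 2 * #|I|]. *)
  apply: contraT => nE; have sI e : e \in E -> e \subset I.
    move=> eE; apply/subsetP=> v ve; have := edge_sub eE ve.
    by rewrite inE => /orP[//|vP]; rewrite (incident_pin eE ve vP) in nE.
  have I2 : (2 <= #|I|)%N.
    have /set0Pn[e eE] := E0.
    by rewrite -(edge_card eE); apply: subset_leq_card; exact: sI.
  have EI : E = edges_within E I.
    by apply/setP=> e; rewrite inE andb_idr //; exact: sI.
  by have := count_inner I2; rewrite -EI cardE; lia.
move=> F F0 pF; have FE := proper_sub pF; rewrite card_incident.
set J := [set v | _].
have JI : J \subset I.
  by apply/subsetP=> v; rewrite inE incident_inner // => /andP[].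
have FJ e v : e \in F -> v \in e -> v \notin P -> v \in J.
  move=> eF ve vP; rewrite inE incident_inner //.
  have := edge_sub (subsetP FE e eF) ve; rewrite inE (negbTE vP) orbF => -> /=.
  by apply/exists_inP; exists e.
have /set0Pn[e eF] := F0; have eE := subsetP FE e eF.
have J0 : J != set0.
  have [v ve vI] := edge_inner eE; apply/set0Pn; exists v.
  by apply: FJ eF ve _; rewrite (disjointFr disj vI).
have [nF|nF] := boolP (None \in inc F); last first.
  have sJ f : f \in F -> f \subset J.
    move=> fF; apply/subsetP=> v vf; apply: (FJ f) => //.
    by apply: contra nF; exact: incident_pin fF vf.
  have J2 : (2 <= #|J|)%N.
    by rewrite -(edge_card eE); apply: subset_leq_card; exact: sJ.
  apply: leq_trans (count_inner J2); rewrite leq_add2r; apply: subset_leq_card.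
  by apply/subsetP=> f fF; rewrite inE (subsetP FE) //= sJ.
suff : (#|F| + 1 <= 2 * #|J|)%N by move: #|F| #|J|; clear; lia.
have [JI'|nJI] := eqVneq J I.
  by rewrite JI' -cardE addn1; exact: proper_card.
have pJ : J :|: P \proper I :|: P.
  rewrite properEneq setSU // andbT; apply: contraNneq nJI => eJP.
  rewrite eqEsubset JI; apply/subsetP=> v vI; have : v \in J :|: P.
    by rewrite eJP inE vI.
  by rewrite inE (disjointFr disj vI) orbF.
have := minG J P JI (subxx _) pJ J0; rewrite -[induced_edges _ _]/(edges_within E (J :|: P)).
have : (#|F| <= #|edges_within E (J :|: P)|)%N.
  apply: subset_leq_card; apply/subsetP=> f fF; rewrite inE (subsetP FE) //=.
  apply/subsetP=> v vf; rewrite inE; have [//|vP] := boolP (v \in P).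
    by rewrite orbT.
  by rewrite (FJ f).
rewrite -card_gt0 in J0.
by move: #|F| #|edges_within _ _| #|J| J0; clear; lia.
Qed.

(** Every vertex lies on an edge, the inner ones by counting and the pins by [noiso]. *)
Lemma spanning_not_proper (I' P' : {set V}) : I' \subset I -> P' \subset P ->
  I' :|: P' \proper I :|: P -> ~~ (E \subset edges_within E (I' :|: P')).
Proof.
move=> I'S P'S pr; apply/negP=> sE; have : I :|: P \subset I' :|: P'.
  apply/subsetP=> v; rewrite inE => /orP[vI|vP].
    have [e eE ve] := inner_covered vI.
    by have := subsetP sE e eE; rewrite inE => /andP[_ /subsetP]; exact.
  have [e eE ve] := noiso vP.
  by have := subsetP sE e eE; rewrite inE => /andP[_ /subsetP]; exact.
by move/(proper_sub_trans pr); rewrite properxx.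
Qed.

(** After contraction the induced edges touch at most [I'] and p*, and [2 * (#|I'| + 1) - 3] is the
    bound wanted. *)
Lemma circuit_minimal : rigidity_circuit (contracted_ends G) E ->
  minimal_pinned G.
Proof.
case=> _ _ circ I' P' I'S P'S pr I'0; rewrite -[induced_edges _ _]/(edges_within E (I' :|: P')).
set F := edges_within E _.
have FE : F \subset E by apply/subsetP=> e; rewrite inE => /andP[].
have [->|F0] := eqVneq F set0; first by rewrite cards0.
have /(circ F F0) : F \proper E by rewrite properE FE spanning_not_proper.
suff : (#|inc F| <= 1 + #|I'|)%N by move: #|F| #|I'| #|inc F|; clear; lia.
rewrite card_incident leq_add ?leq_b1 //; apply: subset_leq_card.
apply/subsetP=> v; rewrite inE incident_inner // => /andP[vI /exists_inP[e eF ve]].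
move: eF; rewrite inE => /andP[_ /subsetP/(_ v ve)]; rewrite inE => /orP[//|vP'].
by have := disjointFr disj vI; rewrite (subsetP P'S).
Qed.

(** * Minimality and motions *)

Lemma minimal_sparse : minimal_pinned G -> forall I' : {set V}, I' \proper I ->
  I' != set0 -> (#|edges_within E (I' :|: P)| + 1 <= 2 * #|I'|)%N.
Proof.
move=> minG I' pI' I'0; have pJ : I' :|: P \proper I :|: P.
  have /properP[sI [v vI vI']] := pI'; apply/properP; split; first exact: setSU.
  by exists v; rewrite !inE ?vI // negb_or vI' (disjointFr disj vI).
have := minG I' P (proper_sub pI') (subxx _) pJ I'0.
rewrite -card_gt0 in I'0; rewrite -[induced_edges _ _]/(edges_within E (I' :|: P)).
by move: #|_| #|I'| I'0; clear; lia.
Qed.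

Lemma minimal_del_vertex v : minimal_pinned G -> v \in I ->
  all_inner_move (del_vertex G v) p0.
Proof.
move=> minG vI; have sub (X : {set V}) :
    (#|edges_within (edges (del_vertex G v)) X| <= #|edges_within E X|)%N.
  by apply: subset_leq_card; apply/subsetP=> e; rewrite !inE => /andP[/andP[-> _] ->].
apply: sparse_all_inner_move.
- split=> [|e]; first exact: disjointWl (subD1set _ _) disj.
  rewrite inE => /andP[eE ve]; have nv x : x \in e -> x != v.
    by move=> xe; apply: contraNneq ve => <-.
  split; first exact: edge_card.
    by apply/subsetP=> x xe; have := edge_sub eE xe; rewrite !inE nv.
  by have [x xe xI] := edge_inner eE; exists x; rewrite // !inE nv.
- move=> X X2; apply: leq_trans (count_inner X2); rewrite leq_add2r; exact: sub.
move=> I' I'S I'0; apply: leq_trans (minimal_sparse minG _ I'0).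
  by rewrite leq_add2r; exact: sub.
exact: sub_proper_trans I'S (properD1 vI).
Qed.

(** Minimality gives the strict count for proper [I'], the missing edge gives it for [I] itself. *)
Lemma minimal_del_edge e : minimal_pinned G -> e \in E ->
  all_inner_move (del_edge G e) p0.
Proof.
move=> minG eE; have sub (X : {set V}) :
    (#|edges_within (edges (del_edge G e)) X| <= #|edges_within E X|)%N.
  by apply: subset_leq_card; apply/subsetP=> f; rewrite !inE => /andP[/andP[_ ->] ->].
apply: sparse_all_inner_move.
- split=> // f; rewrite inE => /andP[_ fE].
  by have := gG.2 f fE.
- move=> X X2; apply: leq_trans (count_inner X2); rewrite leq_add2r; exact: sub.
move=> I' I'S I'0; have [->|nI] := eqVneq I' I.
  rewrite -cardE (cardsD1 e E) eE addnC leq_add2l; apply: subset_leq_card.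
  by apply/subsetP=> f; rewrite inE => /andP[].
apply: leq_trans (minimal_sparse minG _ I'0); last by rewrite properEneq nI.
by rewrite leq_add2r; exact: sub.
Qed.

(** A violation of minimality remains tight when all pins are added. It omits an inner vertex, as it
    would otherwise contain all [2 * #|I|] edges. *)
Lemma tight_witness (I' P' : {set V}) : I' \subset I -> P' \subset P ->
  I' :|: P' \proper I :|: P -> I' != set0 ->
  (2 * #|I'| - 1 < #|induced_edges G (I' :|: P')|)%N ->
  (exists2 w, w \in I & w \notin I') /\
  (2 * #|I'| <= #|edges_within E (I' :|: P)|)%N.
Proof.
move=> I'S P'S pr I'0; rewrite -card_gt0 in I'0.
rewrite -[induced_edges _ _]/(edges_within E (I' :|: P')) => tight.
have t : (2 * #|I'| <= #|edges_within E (I' :|: P')|)%N.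
  by move: #|I'| #|_| I'0 tight; clear; lia.
split; last first.
  apply: leq_trans t _; apply: edges_withinS => e _ eX.
  by apply: subset_trans eX _; exact: setUS.
apply/subsetPn; apply: contra (spanning_not_proper I'S P'S pr) => II'.
have sE : edges_within E (I' :|: P') \subset E.
  by apply/subsetP=> e; rewrite inE => /andP[].
rewrite -(geq_leqif (subset_leqif_card sE)) cardE.
by apply: leq_trans t; rewrite leq_mul2l subset_leq_card.
Qed.

Lemma moving_not_tight (H : pgraph V) (I' : {set V}) w :
  I' \subset I -> I' != set0 -> w \in I -> w \notin I' ->
  (2 * #|I'| <= #|edges_within E (I' :|: P)|)%N ->
  pins H = P -> I' \subset inner H ->
  edges_within E (I' :|: P) \subset edges H -> ~ all_inner_move H p0.
Proof.
move=> I'S /set0Pn[v vI'] wI wI' tight HP I'H FH move_all.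
have [p pP gen] := generic_exists (edges H) (pins H) p0.
have [u mu nz] := move_all p pP gen.
have pinj' : {in P &, injective p}.
  by move=> x y xP yP; rewrite !pP ?HP //; exact: pinj.
have := tight_rigid gG count_inner count_pinned pinj' I'S wI wI' tight HP FH gen mu vI'.
by move=> u0; have := nz v (subsetP I'H v vI'); rewrite u0 eqxx.
Qed.

(** A single inner vertex leaves no nonempty [I'] omitting one. Otherwise deleting [w] outside a
    tight [I'] keeps all edges of the tight part. *)
Lemma del_vertex_minimal :
  (#|I| = 1%N /\ forall v, v \in I -> degree G v = 2%N) \/
    (forall v, v \in I -> all_inner_move (del_vertex G v) p0) ->
  minimal_pinned G.
Proof.
move=> h I' P' I'S P'S pr I'0; rewrite leqNgt; apply/negP=> big.
have [[w wI wI'] tight] := tight_witness I'S P'S pr I'0 big.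
case: h => [[I1 _]|/(_ w wI)].
  have : (#|I'| < #|I|)%N.
    by apply: proper_card; apply/properP; split=> //; exists w.
  by rewrite I1 ltnS leqn0 cards_eq0 (negbTE I'0).
apply: (moving_not_tight I'S I'0 wI wI' tight) => //.
  by rewrite subsetD1 I'S.
apply/subsetP=> e; rewrite !inE => /andP[-> /subsetP eX] /=.
by apply: contra wI' => /eX; rewrite inE (disjointFr disj wI) orbF.
Qed.

(** The tight part has at most [2 * #|I'|] edges, so some edge lies outside it; deleting that edge
    leaves the part rigid. *)
Lemma del_edge_minimal :
  (forall e, e \in E -> all_inner_move (del_edge G e) p0) -> minimal_pinned G.
Proof.
move=> h I' P' I'S P'S pr I'0; rewrite leqNgt; apply/negP=> big.
have [[w wI wI'] tight] := tight_witness I'S P'S pr I'0 big.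
have /subsetPn[e eE eX] : ~~ (E \subset edges_within E (I' :|: P)).
  apply/negP=> /subset_leq_card; rewrite cardE => h'.
  have := leq_trans h' (count_pinned I'S); rewrite leq_mul2l /= leqNgt.
  by rewrite proper_card //; apply/properP; split=> //; exists w.
apply: (moving_not_tight I'S I'0 wI wI' tight) (h e eE) => //.
apply/subsetP=> f fX; rewrite inE; apply/andP; split; last first.
  by move: fX; rewrite inE => /andP[].
by rewrite inE; apply: contraNneq eX => <-.
Qed.

End Assur.

Theorem theorem6 (R : realType) (V : finType) (G : pgraph V)
    (p0 : V -> 'rV[R]_2) :
  pinned_graph G ->
  inner G != set0 ->
  no_isolated_pin G ->
  {in pins G &, injective p0} ->
  pinned_isostatic R G ->
  [<-> minimal_pinned G;
       rigidity_circuit (contracted_ends G) (edges G);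
       (#|inner G| = 1%N /\ forall v, v \in inner G -> degree G v = 2%N) \/
       (forall v, v \in inner G -> all_inner_move (del_vertex G v) p0);
       forall e, e \in edges G -> all_inner_move (del_edge G e) p0].
Proof.
move=> gG I0 noiso pinj iso; tfae.
- exact: minimal_circuit gG I0 iso.
(* This implication and the next both pass through minimality. *)
- move=> /(circuit_minimal gG noiso iso) minG.
  by right=> v vI; exact: minimal_del_vertex gG iso _ minG vI.
- move=> /(del_vertex_minimal gG noiso pinj iso) minG e eE.
  exact: minimal_del_edge gG iso _ minG eE.
- exact: del_edge_minimal gG noiso pinj iso.
Qed.
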